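(* Let $H\subset\mathcal{A}^{\mathbb{Z}}$ be a one-dimensional nearest-neighbor subshift of finite type over a finite alphabet $\mathcal{A}$ whose Rauzy graph $\mathcal{G}(H)$ does not satisfy condition D. Then for any two-dimensional subshift of finite type $Y\subset\mathcal{B}^{\mathbb{Z}^2}$ over a finite alphabet $\mathcal{B}$, there exists a one-dimensional subshift of finite type $V_Y\subset\mathcal{A}^{\mathbb{Z}}$ such that $X_{H,V_Y}$ is an $(m,n)$th root of $Y$ for some positive integers $m,n$. Furthermore, $m$, $n$ and $V_Y$ can be computed algorithmically (from descriptions of $H$ and $Y$ by finite sets of forbidden patterns).
   Context: For one-dimensional subshifts of finite type (SFTs) $H,V\subset\mathcal{A}^{\mathbb{Z}}$, the combined subshift is $$X_{H,V} := \{ x \in \mathcal{A}^{\mathbb{Z}^2} \mid \forall i, j \in \mathbb{Z},\ (x_{k,j})_{k \in \mathbb{Z}} \in H \text{ and } (x_{i,\ell})_{\ell \in \mathbb{Z}} \in V \}.$$ $H$ is nearest-neighbor if it is defined by a set of forbidden words of length $2$. Its Rauzy graph $\mathcal{G}(H)=(\mathcal{V},\vec{E})$ is the directed graph whose vertices are the letters appearing in configurations of $H$, with $(a,b)\in\vec{E}$ iff the word $ab$ appears in some configuration of $H$. The strongly connected components (SCCs) are the maximal sets of mutually reachable vertices; transient vertices (those with no nontrivial path to themselves) do not form SCCs. Condition D: the graph satisfies condition D if all its SCCs have a type in common among the following three (an SCC may have none, one or several types): - $S$ is of reflexive type if $(v,v)\in\vec{E}$ for all $v\in S$; - $S$ is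 of symmetric type if for all $v\neq w\in S$ with $(v,w)\in\vec{E}$ one has $(w,v)\in\vec{E}$; - $S$ is of state-split cycle type if there are $p\geq 1$ and a partition $S=\bigsqcup_{i=0}^{p-1}V_i$ such that for all $i$, all $v\in V_i$ and all $w\in S$: $(v,w)\in\vec{E}\Leftrightarrow w\in V_{i+1 \bmod p}$. Root: let $\sigma^{\vec v}(x)_{\vec k}=x_{\vec k-\vec v}$ be the shift. A subshift $X\subset\mathcal{A}^{\mathbb{Z}^2}$ is an $(m,n)$th root of a subshift $Y\subset\mathcal{B}^{\mathbb{Z}^2}$ if there exist a clopen set $Z\subset X$ with $\sigma^{(m,0)}(Z)=Z$ and $\sigma^{(0,n)}(Z)=Z$, and a homeomorphism $\varphi\colon Z\to Y$, such that $\varphi(\sigma^{(k_1m,k_2n)}(x))=\sigma^{(k_1,k_2)}(\varphi(x))$ for all $x\in Z$, $(k_1,k_2)\in\mathbb{Z}^2$, and $X = \bigsqcup_{0 \leq i < m,\, 0 \leq j < n} \sigma^{(i,j)}(Z)$ (disjoint union). *)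

(* Defs.v *)
From HB Require Import structures.
From Stdlib Require Import Relation_Operators.
From mathcomp Require Import all_boot all_order all_algebra.
From mathcomp Require Import boolp classical_sets functions cardinality topology.

Set Implicit Arguments.
Unset Strict Implicit.
Unset Printing Implicit Defensive.

Import GRing.Theory.
Local Open Scope classical_set_scope.
Local Open Scope ring_scope.

Definition conf2 (A : finType) : Type :=
  prod_topology (fun _ : int * int => discrete_topology A).
HB.instance Definition _ (A : finType) :=
  Topological.copy (conf2 A)
    (prod_topology (fun _ : int * int => discrete_topology A)).

Definition word_at (A : finType) (w : seq A) (x : int -> A) (i : int) : Prop :=
  mkseq (fun k => x (i + k%:Z)) (size w) = w.

Definition sft1 (A : finType) (F : seq (seq A)) : set (int -> A) :=
  [set x | forall w i, w \in F -> ~ word_at w x i].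

Definition is_sft1 (A : finType) (H : set (int -> A)) : Prop :=
  exists F : seq (seq A), H = sft1 F.

Definition length2 (A : finType) (F : seq (seq A)) : bool :=
  all (fun w => size w == 2%N) F.

Definition nearest_neighbor (A : finType) (H : set (int -> A)) : Prop :=
  exists2 F : seq (seq A), length2 F & H = sft1 F.

(* A finite pattern is given by the list of its (position, letter) pairs; a
   list that gives two letters to one position occurs nowhere. *)
Definition pattern (B : finType) := seq ((int * int) * B).

Definition pattern_at (B : finType) (p : pattern B) (y : conf2 B)
    (v : int * int) : Prop :=
  forall c, c \in p -> y (v + c.1) = c.2.

Definition sft2 (B : finType) (F : seq (pattern B)) : set (conf2 B) :=
  [set y | forall p v, p \in F -> ~ pattern_at p y v].

Definition is_sft2 (B : finType) (Y : set (conf2 B)) : Prop :=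
  exists F : seq (pattern B), Y = sft2 F.

Definition combined (A : finType) (H V : set (int -> A)) : set (conf2 A) :=
  [set x | forall i j : int,
     H (fun k => x (k, j)) /\ V (fun l => x (i, l))].

Definition rauzy_edge (A : finType) (H : set (int -> A)) (a b : A) : Prop :=
  exists2 x, H x & exists i, word_at [:: a; b] x i.

Section ConditionD.
Variables (A : finType) (E : A -> A -> Prop).

(* [clos_trans] is reachability by a path of length at least 1, so that a
   transient vertex belongs to no such set. *)
Definition mutually_reachable (S : set A) : Prop :=
  forall v w, S v -> S w -> clos_trans A E v w.

Definition scc (S : set A) : Prop :=
  [/\ S !=set0, mutually_reachable S &
      forall T, S `<=` T -> mutually_reachable T -> T = S].

Definition reflexive_type (S : set A) : Prop := forall v, S v -> E v v.

Definition symmetric_type (S : set A) : Prop :=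
  forall v w, S v -> S w -> v <> w -> E v w -> E w v.

(* [ordS i] is i + 1 mod p. *)
Definition state_split_cycle_type (S : set A) : Prop :=
  exists (p : nat) (V : 'I_p -> set A),
    [/\ (1 <= p)%N,
        [/\ forall i, V i !=set0, trivIset setT V & \bigcup_i V i = S] &
        forall i v w, V i v -> S w -> (E v w <-> V (ordS i) w)].

Definition condition_D : Prop :=
  [\/ forall S, scc S -> reflexive_type S,
      forall S, scc S -> symmetric_type S |
      forall S, scc S -> state_split_cycle_type S].

End ConditionD.

Definition shift2 (A : finType) (v : int * int) (x : conf2 A) : conf2 A :=
  fun k => x (k - v).

Definition homeomorphism (S T : topologicalType) (f : S -> T) : Prop :=
  continuous f /\
  exists g : T -> S, [/\ cancel f g, cancel g f & continuous g].

(* The subsets X, Y, Z carry the induced topology (that of [set_type]). In the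
   equivariance clause, x' is the element of Z underlying
   sigma^(k1 m, k2 n)(x). *)
Definition is_root (A B : finType) (m n : nat)
    (X : set (conf2 A)) (Y : set (conf2 B)) : Prop :=
  exists Z : set (conf2 A),
    [/\ Z `<=` X /\ clopen [set x : set_type X | Z (set_val x)],
        shift2 (m%:Z, 0) @` Z = Z /\ shift2 (0, n%:Z) @` Z = Z,
        exists phi : set_type Z -> set_type Y,
          homeomorphism phi /\
          forall (x x' : set_type Z) (k1 k2 : int),
            set_val x' = shift2 (k1 * m%:Z, k2 * n%:Z) (set_val x) ->
            set_val (phi x') = shift2 (k1, k2) (set_val (phi x)) &
        let T (ij : 'I_m * 'I_n) := shift2 (ij.1%:Z, ij.2%:Z) @` Z in
        X = \bigcup_ij T ij /\ trivIset setT T].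

(* Computability: Kleene's partial recursive functions of one variable, tuples
   being coded by the Cantor pairing function. *)
Definition npair (x y : nat) : nat := ('C((x + y).+1, 2) + y)%N.

Inductive recfun :=
  | RZero
  | RSucc
  | RLeft
  | RRight
  | RPair of recfun & recfun
  | RComp of recfun & recfun
  | RPrec of recfun & recfun
  | RMu of recfun.

(* [computes c x y]: the function coded by c is defined at x, with value y.
   Primitive recursion is h(a, 0) = f(a), h(a, i + 1) = g(a, (i, h(a, i))),
   witnessed by the sequence r of the values h(a, _). *)
Fixpoint computes (c : recfun) (x y : nat) : Prop :=
  match c with
  | RZero => y = 0%N
  | RSucc => y = x.+1
  | RLeft => exists z, x = npair y z
  | RRight => exists z, x = npair z y
  | RPair f g => exists u v, [/\ computes f x u, computes g x v & y = npair u v]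
  | RComp f g => exists2 z, computes g x z & computes f z y
  | RPrec f g => exists (a k : nat) (r : nat -> nat),
      [/\ x = npair a k, computes f a (r 0%N),
          forall i, (i < k)%N -> computes g (npair a (npair i (r i))) (r i.+1) &
          y = r k]
  | RMu f => computes f (npair x y) 0%N /\
      forall i, (i < y)%N -> exists v, computes f (npair x i) v.+1
  end.

Definition code_pair (S T : Type) (f : S -> nat) (g : T -> nat) (p : S * T) :
  nat := npair (f p.1) (g p.2).

Definition code_seq (T : Type) (f : T -> nat) (s : seq T) : nat :=
  foldr (fun t c => (npair (f t) c).+1) 0%N s.

Definition code_int (z : int) : nat :=
  match z with Posz k => k.*2 | Negz k => k.*2.+1 end.

Definition code_letter (A : finType) (a : A) : nat := enum_rank a.

Definition code_words (A : finType) (F : seq (seq A)) : nat :=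
  code_seq (code_seq (@code_letter A)) F.

Definition code_patterns (B : finType) (F : seq (pattern B)) : nat :=
  code_seq
    (code_seq (code_pair (code_pair code_int code_int) (@code_letter B))) F.

Definition code_input (A B : finType) (FH : seq (seq A))
    (FY : seq (pattern B)) : nat :=
  npair (npair #|A| (code_words FH)) (npair #|B| (code_patterns FY)).

Definition code_output (A : finType) (m n : nat) (FV : seq (seq A)) : nat :=
  npair m (npair n (code_words FV)).

(* Main.v *)
(* Fix a set of tiles: horizontal strips of 2R+1 letters of Y, where R bounds
   the positions in the forbidden patterns. A transmission table F(r, i, t),
   periodic of period n in r and m in i, describes the height-n block that a
   column of type i carrying the tile t shows. V_Y consists of the columns that
   are locally stacks of such blocks, of a single type, with tiles in which no
   forbidden pattern of Y occurs. X_{H,V_Y} is an (m,n)th root of Y as soon as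
   - two adjacent columns are compatible with H only if their types are
     i, i + 1 mod m and their blocks are at the same height, and
   - then the tiles are equal or, between type m - 1 and type 0, overlap.
   The readings of a column are unique because its neighbours see them.

   The rows of a table are closed walks of length m in the Rauzy graph. For the
   first condition one needs, for every d other than 1 mod m, a closed walk o
   with no edge from o_0 to o_d: this is non-reflexivity for d = 0,
   non-symmetry for d = -1, and otherwise its absence would make every walk of
   some length k > 1 shortcut by an edge, which forces the component to be a
   state-split cycle. A component that is not a state-split cycle also has
   edges e -> a, e -> a', a' -> b without an edge a -> b; running through
   the loops e a' b .. e and e a .. e in the two possible orders gives two
   closed walks o and f of the same length with no edge from f_i to o_(i+1).
   Rows that show f when the tile is t and o otherwise transmit the tile.
   Finally the rows are arranged in a cyclic order in which every pair of rows
   occurs at every nonzero shift, so that shifted blocks are incompatible.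

   The conditions on a table are decidable: an unbounded search finds one. *)

From Stdlib Require Import Relation_Operators.
Require Import Defs.
From mathcomp Require Import all_boot all_order all_algebra.
From mathcomp Require Import zify ring.
From mathcomp Require Import unstable boolp classical_sets functions topology.

Set Implicit Arguments.
Unset Strict Implicit.
Unset Printing Implicit Defensive.

Import GRing.Theory.

(** * Walks in a finite directed graph *)

Section Walks.
Variables (A : finType) (E : rel A).

Definition walk (k : nat) (a b : A) : Prop :=
  exists p, [/\ path E a p, size p = k & last a p = b].

Lemma walk0 a b : walk 0 a b <-> a = b.
Proof. by split=> [[[|? ?] [//= _ _ ->]]//|->]; exists [::]. Qed.

Lemma walk_cat k l a b c : walk k a b -> walk l b c -> walk (k + l) a c.
Proof.
move=> [p [pP <- <-]] [p' [pP' <- <-]]; exists (p ++ p').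
by rewrite cat_path pP pP' size_cat last_cat.
Qed.

Lemma walk_split k l a c :
  walk (k + l) a c -> exists2 b, walk k a b & walk l b c.
Proof.
move=> [p [pP sp <-]]; rewrite -[p](cat_take_drop k) cat_path in pP *.
case/andP: pP => pP pP'; rewrite last_cat; eexists.
  by exists (take k p); rewrite pP size_takel // sp leq_addr.
by exists (drop k p); rewrite pP' size_drop sp addKn.
Qed.

Lemma walk1 a b : walk 1 a b <-> E a b.
Proof.
split=> [[[|c [|? ?]] [//= /andP[ac _] _ <-]]//|ab].
by exists [:: b]; rewrite /= ab.
Qed.

Lemma walk_cons k a b c : E a b -> walk k b c -> walk k.+1 a c.
Proof. by move=> /walk1; apply: walk_cat. Qed.

Lemma walk_uncons k a c : walk k.+1 a c -> exists2 b, E a b & walk k b c.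
Proof. by move=> /(@walk_split 1)[b /walk1]; exists b. Qed.

Lemma walk_rcons k a b c : walk k a b -> E b c -> walk k.+1 a c.
Proof. by rewrite -addn1 => ab /walk1; apply: walk_cat ab. Qed.

Lemma walk_iter n k a : walk k a a -> walk (n * k) a a.
Proof.
move=> aa; elim: n => [|n IH]; first exact/walk0.
by rewrite mulSn; apply: walk_cat IH.
Qed.

Lemma clos_trans_walk a b : clos_trans A E a b <-> exists k, walk k.+1 a b.
Proof.
split.
  elim=> [x y /walk1 xy|x y z _ [k xy] _ [l yz]]; first by exists 0.
  by exists (k + l.+1); exact: walk_cat xy yz.
move=> [k]; elim: k a => [|k IH] a; first by move=> /walk1; apply: t_step.
by move=> /walk_uncons[c ac /IH]; apply: t_trans; apply: t_step.
Qed.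

Definition walk_period (N q : nat) : Prop :=
  0 < q /\ forall k c a b, N <= k -> (walk (k + c * q) a b <-> walk k a b).

Lemma walk_eventually_periodic : exists N q, walk_period N q.
Proof.
pose W k : {ffun A * A -> bool} := [ffun p => `[< walk k p.1 p.2 >]].
have : ~~ injectiveb (fun i : 'I_#|{ffun A * A -> bool}|.+1 => W i).
  by apply/negP => /injectiveP /leq_card; rewrite card_ord ltnn.
move=> /injectivePn[i [j ij Wij]].
wlog lt_ij : i j ij Wij / i < j => [hw|].
  case: (ltngtP i j) => ord_ij; first exact: hw ord_ij.
    by apply: hw ord_ij => //; rewrite eq_sym.
  by rewrite (val_inj ord_ij) eqxx in ij.
have walk_ij a b : walk i a b <-> walk j a b.
  have := congr1 (fun f : {ffun _} => f (a, b)) Wij; rewrite !ffunE /= => e.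
  by split=> /asboolP; [rewrite e|rewrite -e] => /asboolP.
have walk_add k a b : walk (i + k) a b <-> walk (j + k) a b.
  by split=> /walk_split[c /walk_ij ac cb]; apply: walk_cat cb.
exists i, (j - i); split=> [|k c a b ik]; first by rewrite subn_gt0.
elim: c => [|c <-]; first by rewrite mul0n addn0.
have -> : k + c * (j - i) = i + (k - i + c * (j - i)) by lia.
by rewrite walk_add; have -> : k + c.+1 * (j - i) = j + (k - i + c * (j - i)) by lia.
Qed.

End Walks.

Local Notation reversed E := (fun a b => E b a).

Lemma walk_reversed (A : finType) (E : rel A) k a b :
  walk (reversed E) k b a <-> walk E k a b.
Proof.
suff rev_walk (E' : rel A) x y : walk E' k x y -> walk (reversed E') k y x.
  by split; apply: rev_walk.
move=> [p [pP <- <-]]; exists (rev (belast x p)); rewrite rev_path pP.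
split=> //; first by rewrite size_rev size_belast.
by case: p {pP} => //= y' p; rewrite rev_cons last_rcons.
Qed.

(** * Components that are not state-split cycles *)

Section Components.
Variable A : finType.

Definition strong_component (E : rel A) (S : set A) : Prop :=
  (forall x y, S x -> S y -> exists k, walk E k.+1 x y) /\
  (forall x y u k l, S x -> S y -> walk E k x u -> walk E l u y -> S u).

Lemma scc_strong_component (E : rel A) (S : set A) :
  scc (fun a b => E a b) S -> strong_component E S.
Proof.
move=> [_ mr mx]; split=> [x y Sx Sy|x y u k l Sx Sy xu uy].
  by apply/clos_trans_walk; apply: mr.
case: l uy => [/walk0->//|l uy]; case: k xu => [/walk0<-//|k xu].
pose T v := clos_trans A E x v /\ clos_trans A E v x.
have <- : T = S.
  apply: mx => [v Sv|v w [xv vx] [xw wx]]; first by split; apply: mr.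
  exact: t_trans vx xw.
split; first by apply/clos_trans_walk; exists k.
by apply: (t_trans _ _ _ y); [apply/clos_trans_walk; exists l|apply: mr].
Qed.

Lemma strong_component_reversed (E : rel A) (S : set A) :
  strong_component E S -> strong_component (reversed E) S.
Proof.
move=> [conn clsd]; split=> [x y Sx Sy|x y u k l Sx Sy].
  by have [k yx] := conn y x Sy Sx; exists k; apply/walk_reversed.
by move=> /walk_reversed xu /walk_reversed uy; apply: (clsd y x u l k).
Qed.

Definition siblings_share_successors (E : rel A) (S : set A) : Prop :=
  forall e a a' b, S e -> S a -> S a' -> S b ->
  E e a -> E e a' -> E a b -> E a' b.

Section Component.
Variables (E : rel A) (S : set A).
Hypothesis compS : strong_component E S.

Let conn x y : S x -> S y -> exists k, walk E k.+1 x y.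
Proof. by case: compS => conn _; exact: conn. Qed.

Lemma component_split x y k l : S x -> S y -> walk E (k + l) x y ->
  exists u, [/\ S u, walk E k x u & walk E l u y].
Proof.
case: compS => _ clsd Sx Sy /walk_split[u xu uy]; exists u; split=> //.
exact: clsd xu uy.
Qed.

Lemma component_uncons x y k : S x -> S y -> walk E k.+1 x y ->
  exists u, [/\ S u, E x u & walk E k u y].
Proof.
move=> Sx Sy /(component_split (k := 1) Sx Sy)[u [Su /walk1 xu uy]].
by exists u.
Qed.

Lemma component_unrcons x y k : S x -> S y -> walk E k.+1 x y ->
  exists u, [/\ S u, walk E k x u & E u y].
Proof.
rewrite -addn1 => Sx Sy /(component_split Sx Sy)[u [Su xu /walk1 uy]].
by exists u.
Qed.

Lemma same_level_same_successors k e u u' w :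
    siblings_share_successors E S -> S e -> S u -> S u' -> S w ->
  walk E k e u -> walk E k e u' -> E u w -> E u' w.
Proof.
move=> sib Se; elim: k u u' w => [|k IH] u u' w Su Su' Sw.
  by move=> /walk0<- /walk0<-.
move=> /(component_unrcons Se Su)[y [Sy ey yu]].
move=> /(component_unrcons Se Su')[y' [Sy' ey' yu']] uw.
by apply: (sib y' u) => //; apply: IH yu.
Qed.

Lemma siblings_share_successors_of_shortcuts j : 1 < j ->
    (forall a b, S a -> S b -> walk E j a b -> E a b) ->
  siblings_share_successors E S.
Proof.
move=> j1 shortcut.
have shortcuts k a b : S a -> S b -> walk E (k * j.-1).+1 a b -> E a b.
  elim: k a => [|k IH] a Sa Sb; first by rewrite mul0n => /walk1.
  rewrite (_ : _.+1 = j + k * j.-1); last by lia.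
  move=> /(component_split Sa Sb)[c [Sc ac cb]].
  by apply: IH => //; apply: walk_cons cb; apply: shortcut.
move=> e a a' b Se Sa Sa' Sb ea ea' ab; have [d a'e] := conn Sa' Se.
apply: (shortcuts d.+2) => //.
rewrite (_ : _.+1 = j.-2 * d.+2 + (d.+1 + 2)); last by nia.
apply: walk_cat (walk_iter _ (walk_rcons a'e ea')) _.
by apply: walk_cat a'e _; apply: walk_cons ea _; apply/walk1.
Qed.

Lemma walk_reversal_shortcut l :
    (forall a b, S a -> S b -> walk E l b a -> E a b) ->
  forall a b, S a -> S b -> walk E (l * l) a b -> E a b.
Proof.
move=> back; have back_iter k a b : S a -> S b -> walk E (k * l) a b -> walk E k b a.
  elim: k a => [|k IH] a Sa Sb.
    by rewrite mul0n => /walk0<-; apply/walk0.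
  rewrite mulSn => /(component_split Sa Sb)[c [Sc ac cb]].
  by apply: walk_rcons (back _ _ Sc Sa ac); apply: IH.
by move=> a b Sa Sb /back_iter ba; apply: back => //; apply: ba.
Qed.

Section Levels.
Variable e0 : A.
Hypotheses (Se0 : S e0) (sib : siblings_share_successors E S).

Definition level (k : nat) (v : A) : Prop := S v /\ walk E k e0 v.

Lemma level_succ k v w : level k v -> S w -> (E v w <-> level k.+1 w).
Proof.
move=> [Sv e0v] Sw; split=> [vw|[_]]; first by split=> //; apply: walk_rcons vw.
move=> /(component_unrcons Se0 Sw)[u [Su e0u uw]].
exact: (same_level_same_successors sib Se0 Su Sv Sw e0u e0v uw).
Qed.

(* Not so at level 0, which is {e0}: a block may contain other vertices. *)
Lemma level_confluent k l v s w :
  level k v -> level l v -> level (k + s.+1) w -> level (l + s.+1) w.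
Proof.
move=> kv lv [Sw]; rewrite addnS -addSn => /(component_split Se0 Sw)[c [Sc e0c cw]].
split=> //; rewrite addnS -addSn; apply: walk_cat cw.
by have [] : level l.+1 c by apply/(level_succ lv) => //; apply/(level_succ kv).
Qed.

Lemma level_periodic p c k w : walk E p e0 e0 ->
  level (c * p + k.+1) w <-> level k.+1 w.
Proof.
move=> e0e0; have e0_0 : level 0 e0 by split=> //; apply/walk0.
have e0_c : level (c * p) e0 by split=> //; apply: walk_iter.
by split; [apply: (level_confluent e0_c e0_0)|apply: (level_confluent e0_0 e0_c)].
Qed.

Lemma level_disjoint p i j v : walk E p e0 e0 ->
    (forall k, walk E k.+1 e0 e0 -> p <= k.+1) ->
  i < j -> j < p -> level i.+1 v -> level j.+1 v -> False.
Proof.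
move=> e0e0 pmin ij jp iv jv.
have /(level_confluent jv iv) : level (j.+1 + (p + (p - j.+1)).-1.+1) e0.
  rewrite (_ : _ + _ = 1 * p + p.-1.+1); last by lia.
  by apply/level_periodic => //; split=> //; rewrite prednK //; lia.
rewrite (_ : _ + _ = 1 * p + (p - (j - i)).-1.+1); last by lia.
by move=> /(level_periodic _ _ _ e0e0)[_ /pmin]; lia.
Qed.

(* The blocks of the cyclic partition are the levels 1, ..., p, where p is the
   length of the shortest closed walk at e0. *)
Lemma state_split_cycle_of_levels : state_split_cycle_type (fun a b => E a b) S.
Proof.
have ex_p : exists k, `[< walk E k.+1 e0 e0 >].
  by have [k e0e0] := conn Se0 Se0; exists k; apply/asboolP.
case: (ex_minnP ex_p) => p' /asboolP e0e0 pmin; pose p := p'.+1.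
have period c k w := @level_periodic p c k w e0e0.
have {}pmin k : walk E k.+1 e0 e0 -> p <= k.+1 by move=> /asboolP /pmin.
exists p, (fun i : 'I_p => level i.+1); split=> //; first split.
- move=> i; have : walk E (i.+1 + (p - i.+1)) e0 e0 by rewrite subnKC.
  by move=> /(component_split Se0 Se0)[c [Sc e0c _]]; exists c.
- move=> i j _ _ [v [iv jv]]; apply: val_inj.
  by case: (ltngtP i j) => // [/level_disjoint|/level_disjoint] disj;
    case: (disj p v e0e0 pmin).
- apply/predeqP => v; split=> [[i _ []]//|Sv]; have [k e0v] := conn Se0 Sv.
  exists (Ordinal (ltn_pmod k (ltn0Sn p'))) => //=.
  by apply/(period (k %/ p)); rewrite addnS -divn_eq.
move=> i v w iv Sw; rewrite (level_succ iv Sw) /=.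
have := ltn_ord i; rewrite leq_eqVlt => /orP[/eqP ip|ip]; last by rewrite modn_small.
by rewrite ip modnn; have := period 1 0 w; rewrite mul1n addn1.
Qed.

End Levels.
End Component.

Lemma siblings_share_successors_reversed (E : rel A) (S : set A) :
    strong_component E S ->
  siblings_share_successors (reversed E) S -> siblings_share_successors E S.
Proof.
move=> comp sib e a a' b Se Sa Sa' Sb ea ea' ab; have [conn _] := comp.
have [k1 be] := conn b e Sb Se; have [k2 a'e] := conn a' e Sa' Se.
have [x [Sx a'x xe]] := component_uncons comp Sa' Se a'e.
apply: (@same_level_same_successors _ _ (strong_component_reversed comp)
  (k1.+1 + k2.+2) e x b a') => //; apply/walk_reversed.
  rewrite (_ : _ + _ = k2 + k1.+3); last by lia.
  by apply: walk_cat xe _; apply: walk_cons ea _; apply: walk_cons ab _.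
by apply: walk_cat be _; apply: walk_cons ea' _.
Qed.

End Components.

(** * Closed walks without prescribed chords *)

Lemma component_return (A : finType) (E : rel A) (S : set A) N q j k a b :
    walk_period E N q -> strong_component E S -> S a -> S b ->
  walk E j a b -> N <= k -> q %| j + k -> walk E k b a.
Proof.
move=> [q0 per] [conn _] Sa Sb ab Nk qjk; have [d ba] := conn b a Sb Sa.
pose c := q * k.+1; pose l := c.-1 * (d.+1 + j) + d.+1.
have l_walk : walk E l b a.
  by apply: (walk_cat _ ba); apply: walk_iter; apply: walk_cat ba ab.
have c0 : 0 < c by rewrite muln_gt0 q0.
have kc : k < c by apply: leq_trans (leq_pmull _ _).
have lj : l + j = c * (d.+1 + j) by rewrite /l -{2}(prednK c0) mulSn; lia.
have kl : k <= l by rewrite /l; nia.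
have /dvdnP[x lk] : q %| l - k.
  rewrite -(subnDr j) lj [k + j]addnC; apply: dvdn_sub => //.
  by rewrite /c -mulnA dvdn_mulr.
by apply/(per _ x _ _ Nk); rewrite -lk subnKC.
Qed.

Definition chordless_closed_walk (A : finType) (E : rel A) (m d : nat) : Prop :=
  exists a b, [/\ walk E d a b, walk E (m - d) b a & ~~ E a b].

Lemma chordless_loop (A : finType) (E : rel A) l m v :
  walk E l v v -> ~~ E v v -> l %| m -> chordless_closed_walk E m 0.
Proof.
move=> vv nv /dvdnP[k ->]; exists v, v; split=> //; first exact/walk0.
by rewrite subn0; apply: walk_iter.
Qed.

Lemma chordless_oneway (A : finType) (E : rel A) l m v w :
    walk E l w v -> E v w -> ~~ E w v -> 0 < m -> l.+1 %| m ->
  chordless_closed_walk E m m.-1.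
Proof.
move=> wv vw nwv m0 /dvdnP[[|k] mk]; first by rewrite mk in m0.
exists w, v; split=> //; last by rewrite (_ : m - m.-1 = 1) ?walk1 //; lia.
rewrite mk mulSn addSn /= addnC; apply: (walk_cat _ wv).
by apply: walk_iter; apply: walk_rcons wv vw.
Qed.

Lemma chordless_component (A : finType) (E : rel A) (S : set A) m N q d :
    walk_period E N q -> strong_component E S -> ~ siblings_share_successors E S ->
    q %| m -> 2 * N <= m -> 1 < d -> d + 1 < m ->
  chordless_closed_walk E m d.
Proof.
move=> per comp nsib qm Nm d1 dm; apply: contrapT => nchordless.
have chord a b : walk E d a b -> walk E (m - d) b a -> E a b.
  by move=> ab ba; apply/negPn/negP => nab; apply: nchordless; exists a, b.
have come_back j k a b := @component_return _ _ _ _ _ j k a b per comp.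
have qm' : q %| d + (m - d) by rewrite subnKC //; lia.
apply: nsib; have [short|long] := leqP d (m - d).
  apply: (siblings_share_successors_of_shortcuts comp d1) => a b Sa Sb ab.
  by apply: chord => //; apply: come_back ab _ qm' => //; lia.
apply: (@siblings_share_successors_of_shortcuts _ _ _ comp ((m - d) * (m - d))).
  by have : 1 < m - d by [lia]; nia.
apply: (walk_reversal_shortcut comp) => a b Sa Sb ba; apply: chord => //.
by apply: come_back ba _ _ => //; [lia|rewrite addnC].
Qed.

Lemma not_condition_D_witnesses (A : finType) (E : rel A) :
  ~ condition_D (fun a b => E a b) ->
  [/\ exists l v, walk E l.+1 v v /\ ~~ E v v,
      exists l v w, [/\ walk E l w v, E v w & ~~ E w v] &
      exists S, strong_component E S /\ ~ siblings_share_successors E S].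
Proof.
move=> nD; split; apply: contrapT => no; apply: nD.
- constructor 1 => S sS v Sv; apply: contrapT => nE; apply: no.
  have [conn _] := scc_strong_component sS; have [l vv] := conn v v Sv Sv.
  by exists l, v; split=> //; exact/negP.
- constructor 2 => S sS v w Sv Sw _ vw; apply: contrapT => nE; apply: no.
  have [conn _] := scc_strong_component sS; have [l wv] := conn w v Sw Sv.
  by exists l.+1, v, w; split=> //; exact/negP.
- constructor 3 => S sS; have comp := scc_strong_component sS.
  have [[e Se] _ _] := sS; apply: (state_split_cycle_of_levels comp Se).
  by apply: contrapT => nsib; apply: no; exists S.
Qed.

Lemma dvdn_prod_seq (qs : seq nat) q :
  q \in qs -> q %| \prod_(p <- qs) p.
Proof. by move=> qqs; rewrite (big_rem q) //= dvdn_mulr. Qed.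

Lemma chordless_closed_walks (A : finType) (E : rel A) :
  ~ condition_D (fun a b => E a b) ->
  exists2 M, 0 < M & forall m d, M %| m -> d < m -> d != 1 ->
    chordless_closed_walk E m d.
Proof.
move=> /not_condition_D_witnesses[].
move=> [l1 [v1 [loop1 n1]]] [l2 [v2 [w2 [back2 e2 n2]]]] [S [comp nsib]].
have [N [q per]] := walk_eventually_periodic E; have [q0 _] := per.
pose ks := [:: l1.+1; l2.+1; q; (2 * N).+1]; pose M := \prod_(k <- ks) k.
exists M => [|m d Mm dm d1]; first by rewrite /M !big_cons big_nil !muln_gt0 q0.
have m0 : 0 < m by apply: leq_trans dm.
have dvd_m k : k \in ks -> k %| m by move=> /dvdn_prod_seq /dvdn_trans ->.
have [->|d0] := eqVneq d 0.
  by apply: chordless_loop loop1 n1 (dvd_m _ _); rewrite !inE eqxx.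
have [->|dm1] := eqVneq d m.-1.
  by apply: chordless_oneway back2 e2 n2 m0 (dvd_m _ _); rewrite !inE eqxx orbT.
have Nm : 2 * N < m by apply/(dvdn_leq m0)/dvd_m; rewrite !inE eqxx !orbT.
have qm : q %| m by apply: dvd_m; rewrite !inE eqxx !orbT.
by apply: (chordless_component per comp nsib qm (ltnW Nm)); lia.
Qed.

(** * Periodic functions and residues of integers *)

Local Open Scope ring_scope.

Definition periodic (T : Type) (n : nat) (f : int -> T) :=
  forall i, f (i + n%:Z) = f i.

Lemma periodic_mul T n (f : int -> T) i k :
  periodic n f -> f (i + k * n%:Z) = f i.
Proof.
move=> pf; have pos (l : nat) j : f (j + l%:Z * n%:Z) = f j.
  elim: l => [|l IH]; first by rewrite mul0r addr0.
  by rewrite -IH -[RHS]pf; congr f; lia.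
by case: k => k; rewrite ?pos // -[LHS](pos k.+1); congr f; rewrite NegzE; ring.
Qed.

Lemma eq_periodic T n (f : int -> T) i j :
  periodic n f -> (i = j %[mod n])%Z -> f i = f j.
Proof.
move=> pf /eqP; rewrite eqz_mod_dvd => /dvdzP[k ij].
by rewrite -(periodic_mul j k pf) -ij addrC subrK.
Qed.

Lemma int_residue (n : nat) (i : int) : (0 < n)%N ->
  exists2 k : nat, (k < n)%N & (i = k%:Z %[mod n])%Z.
Proof.
move=> n0; have n_neq0 : n%:Z != 0 by lia.
exists `|(i %% n)%Z|%N; last by rewrite gez0_abs ?modz_mod ?modz_ge0.
by rewrite -ltz_nat gez0_abs ?modz_ge0 // ltz_pmod.
Qed.

Lemma absz_mod (n : nat) (i : int) (k : nat) :
  (k < n)%N -> (i = k%:Z %[mod n])%Z -> absz (i %% n)%Z = k.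
Proof. by move=> kn ->; rewrite modz_small. Qed.

Lemma eq_mod_dvdz (n i j : int) : (i = j %[mod n])%Z -> (n %| i)%Z = (n %| j)%Z.
Proof. by move=> ij; apply/dvdz_mod0P/dvdz_mod0P; rewrite ij. Qed.

Lemma dvdz_small (n : nat) (i : int) : `|i| < n%:Z -> (n %| i)%Z = (i == 0).
Proof.
move=> lt_in; apply/idP/eqP => [|->]; last exact: dvdz0.
by rewrite dvdzE => /dvdn_leq; lia.
Qed.

Lemma dvdz_succ_small (n k : nat) : (k < n)%N -> (n %| k%:Z + 1)%Z = (k.+1 == n).
Proof.
rewrite leq_eqVlt => /orP[/eqP kn|kn].
  by rewrite (_ : k%:Z + 1 = n%:Z) ?dvdzz ?kn ?eqxx //; lia.
by rewrite dvdz_small; lia.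
Qed.

(** * Words in which every pair of letters occurs at every shift *)

Lemma chinese_remainder_seq (qs : seq nat) (a : nat -> int) :
  pairwise coprime qs ->
  exists r : int, forall q, q \in qs -> (r = a q %[mod q])%Z.
Proof.
elim: qs => [|q qs IH] /=; first by exists 0.
case/andP => /allP co_q /IH[r rP].
pose Q := (\prod_(p <- qs) p)%N.
have co : coprimez q Q.
  by rewrite coprimezE /Q big_seq; apply: (big_ind (coprime q)) => //;
    [rewrite coprimen1|move=> x y co_x co_y; rewrite coprimeMr co_x].
exists (zchinese q Q (a q) r) => p; rewrite inE => /orP[/eqP->|pqs].
  exact: zchinese_modl.
rewrite -(rP p pqs); apply/eqP; rewrite eqz_mod_dvd.
apply: (@dvdz_trans Q); first by rewrite dvdzE; apply: dvdn_prod_seq.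
by rewrite -eqz_mod_dvd; apply/eqP; exact: zchinese_modr.
Qed.

Lemma dvdz_prescribed_at_shift (q : nat) (psi : int) (x y : bool) :
    (2 < q)%N -> (if (q %| psi)%Z then x == y else ~~ (x && y)) ->
  exists a : int, (q %| a)%Z = x /\ (q %| a + psi)%Z = y.
Proof.
move=> q2; case: x => [|/=] xy.
  by exists 0; rewrite dvdz0 add0r; case: (_ %| _)%Z y xy => -[].
have q1 : (q %| 1)%Z = false by rewrite dvdz1; lia.
case: y xy => [xy|_].
  by exists (- psi); rewrite addNr dvdz0 dvdzE abszN -dvdzE; case: (_ %| _)%Z xy.
have [qpsi|qpsi] := boolP (q %| 1 + psi)%Z; last by exists 1; rewrite q1 (negbTE qpsi).
exists 2; split; first by apply/negbTE/negP; rewrite dvdzE => /dvdn_leq; lia.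
have -> : 2 + psi = 1 + (1 + psi) by ring.
by rewrite rpredDr ?q1.
Qed.

(* The set of the moduli that divide r and the set of those that divide r + psi
   can be prescribed independently, except that a modulus dividing psi divides
   both or none. *)
Lemma dvdz_prescribed_seq (qs : seq nat) (psi : int) (x y : pred nat) :
    pairwise coprime qs -> all (ltn 2) qs ->
    (forall q, q \in qs -> if (q %| psi)%Z then x q == y q else ~~ (x q && y q)) ->
  exists r : int, {in qs, forall q : nat, (q %| r)%Z = x q} /\
                  {in qs, forall q : nat, (q %| r + psi)%Z = y q}.
Proof.
move=> co_qs /allP qs2 xy.
have /choice[a aP] q : exists b : int,
    q \in qs -> (q %| b)%Z = x q /\ (q %| b + psi)%Z = y q.
  have [qqs|_] := boolP (q \in qs); last by exists 0.
  by have [b bP] := dvdz_prescribed_at_shift (qs2 q qqs) (xy q qqs); exists b.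
have [r rP] := chinese_remainder_seq a co_qs.
exists r; split=> q qqs; have [ax ay] := aP q qqs.
  by rewrite (eq_mod_dvdz (rP q qqs)).
by rewrite -ay; apply: eq_mod_dvdz; rewrite -modzDml rP // modzDml.
Qed.

Lemma exists_primes_gt (k N : nat) : exists qs : seq nat,
  [/\ size qs = N, uniq qs, all prime qs & all (ltn k) qs].
Proof.
elim: N => [|N [qs [sz un pr gt]]]; first by exists [::].
have [p qp pp] := prime_above (k + \sum_(q <- qs) q)%N.
have p_fresh : p \notin qs.
  by apply: contraL qp => pqs; rewrite -leqNgt (big_rem p) //= addnCA leq_addr.
by exists (p :: qs); rewrite /= sz p_fresh un pp pr gt andbT; split=> //; lia.
Qed.

Lemma pairwise_coprime_primes (qs : seq nat) :
  uniq qs -> all prime qs -> pairwise coprime qs.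
Proof.
elim: qs => //= p qs IH /andP[pqs un] /andP[pp prs]; rewrite IH // andbT.
apply/allP => q qqs; rewrite prime_coprime // dvdn_prime2 ?(allP prs q qqs) //.
by apply: contraNneq pqs => ->.
Qed.

Lemma consecutive_pairs (K : finType) (k0 : K) :
  exists (g : nat -> K) (M : nat),
    forall k l, exists c, [/\ (c < M)%N, g c = k & g c.+1 = l].
Proof.
pose s := flatten [seq [:: p.1; p.2] | p <- enum {: K * K}].
exists (nth k0 s), (size s) => k l.
rewrite /s; have : (k, l) \in enum {: K * K} by rewrite mem_enum.
elim: (enum _) => //= p ps IH; rewrite inE => /orP[/eqP<-|/IH[c [cs ck cl]]].
  by exists 0%N.
by exists c.+2.
Qed.

Lemma count_mem_subseq (T : eqType) (s t : seq T) :
  uniq t -> {subset s <= t} -> uniq s -> count (mem s) t = size s.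
Proof.
move=> ut st us; rewrite -size_filter; apply/perm_size/uniq_perm => //.
  exact: filter_uniq.
by move=> x; rewrite mem_filter andb_idr //; apply: st.
Qed.

Definition divisor_count (qs : seq nat) (r : int) : nat :=
  count (fun q : nat => (q %| r)%Z) qs.

Lemma divisor_count_at_shift (qs : seq nat) (psi : int) (a b c : nat) :
    uniq qs -> pairwise coprime qs -> all (ltn 2) qs ->
    (c <= divisor_count qs psi)%N -> (a + b <= size qs - divisor_count qs psi)%N ->
  exists r, divisor_count qs r = (c + a)%N /\ divisor_count qs (r + psi) = (c + b)%N.
Proof.
move=> un co gt2; rewrite -(count_predC (fun q : nat => (q %| psi)%Z)).
rewrite /divisor_count addKn -!size_filter; set dvd := [seq q <- qs | _].
set ndvd := [seq q <- qs | _] => cD abN.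
pose both := take c dvd; pose first := take a ndvd; pose second := take b (drop a ndvd).
have in_both q : q \in both -> q \in qs /\ (q %| psi)%Z.
  by move=> /mem_take; rewrite mem_filter => /andP[].
have in_ndvd q : q \in ndvd -> q \in qs /\ ~~ (q %| psi)%Z.
  by rewrite mem_filter => /andP[].
have in_first q : q \in first -> q \in ndvd by exact: mem_take.
have in_second q : q \in second -> q \in ndvd by move=> /mem_take/mem_drop.
have disj q : q \in first -> q \in second -> False.
  move=> q1 q2; have := filter_uniq (predC (fun q : nat => (q %| psi)%Z)) un.
  rewrite -/ndvd -[ndvd](cat_take_drop a) cat_uniq => /and3P[_ /hasPn/(_ q) + _].
  by rewrite (mem_take q2) => /(_ isT); rewrite q1.
have [q qqs|r [rX rY]] := @dvdz_prescribed_seq qs psi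
    (mem (both ++ first)) (mem (both ++ second)) co gt2.
  rewrite /= !mem_cat; have [qpsi|qpsi] := boolP (q %| psi)%Z.
    have out (s : seq nat) : {subset s <= ndvd} -> (q \in s) = false.
      by move=> sN; apply/negP => /sN/in_ndvd[_]; rewrite qpsi.
    by rewrite (out first) // (out second) // !orbF.
  have -> : (q \in both) = false by apply/negP => /in_both[_]; apply/negP.
  by apply/negP => /andP[/disj].
have count_both (s : seq nat) : uniq s -> {subset s <= ndvd} ->
    count (mem (both ++ s)) qs = (c + size s)%N.
  move=> us sN; rewrite count_mem_subseq ?size_cat ?size_takel //.
  - by move=> q; rewrite mem_cat => /orP[/in_both[]//|/sN/in_ndvd[]].
  - rewrite cat_uniq us take_uniq ?filter_uniq //= andbT.
    by apply/hasPn => q /sN/in_ndvd[_ nq]; apply: contra nq => /in_both[].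
exists r; split; [rewrite (eq_in_count rX)|rewrite (eq_in_count rY)];
  rewrite count_both ?size_takel ?size_drop ?take_uniq ?drop_uniq ?filter_uniq //; lia.
Qed.

(* A position is labelled by the number of moduli that divide it. If many
   moduli divide psi, they provide any common number of divisors of r and
   r + psi, and one of the other moduli makes the second number larger by one;
   if few do, both numbers can be prescribed. *)
Lemma all_pairs_at_all_shifts (K : finType) (k0 : K) :
  exists (n : nat) (w : int -> K),
  [/\ (1 < n)%N, periodic n w &
      forall psi, ~~ (n %| psi)%Z ->
      forall k l, exists r, w r = k /\ w (r + psi) = l].
Proof.
have [g [M pairsM]] := consecutive_pairs k0.
have M0 : (0 < M)%N by case: (pairsM k0 k0) => c [cM _ _]; lia.
have [qs [sz un pr gt2]] := exists_primes_gt 2 (3 * M).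
have co := pairwise_coprime_primes un pr.
pose n := (\prod_(q <- qs) q)%N.
exists n, (g \o divisor_count qs); split=> [|r|psi npsi k l] /=.
- have n0 : (0 < n)%N.
    by rewrite /n big_seq; apply: prodn_cond_gt0 => q /(allP gt2); apply: leq_trans.
  have /hasP[q qqs _] : has predT qs by rewrite has_predT sz; lia.
  exact: leq_trans (ltnW (allP gt2 q qqs)) (dvdn_leq n0 (dvdn_prod_seq qqs)).
- by congr g; apply: eq_in_count => q /dvdn_prod_seq qn; rewrite rpredDr.
have nd : (divisor_count qs psi < 3 * M)%N.
  rewrite -sz ltn_neqAle count_size andbT -all_count; apply: contra npsi => /allP dvd.
  rewrite dvdzE; apply/Gauss_dvd_prod => [|q qqs _]; last exact: dvd.
  by rewrite filter_predT map_id.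
have [few|many] := ltnP (divisor_count qs psi) M.
  have [a [aM <- _]] := pairsM k k; have [b [bM <- _]] := pairsM l l.
  have abP : (a + b <= size qs - divisor_count qs psi)%N by rewrite sz; lia.
  have [r [count_r count_s]] := divisor_count_at_shift un co gt2 (leq0n _) abP.
  by exists r; rewrite count_r count_s.
have [c [cM <- <-]] := pairsM k l.
have cP : (c <= divisor_count qs psi)%N by apply: leq_trans many; apply: ltnW.
have oneP : (0 + 1 <= size qs - divisor_count qs psi)%N by rewrite sz; lia.
have [r [count_r count_s]] := divisor_count_at_shift un co gt2 cP oneP.
by exists r; rewrite count_r count_s addn0 addn1.
Qed.

(** * Separating closed walks *)

Definition closed_walk (A : Type) (E : rel A) (m : nat) (o : int -> A) : Prop :=
  periodic m o /\ forall i, E (o i) (o (i + 1)).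

Section ClosedWalks.
Variables (A : finType) (E : rel A).

Lemma closed_walk_shift m o s :
  closed_walk E m o -> closed_walk E m (fun i => o (i + s)).
Proof. by move=> [per oE]; split=> i; rewrite addrAC. Qed.

Lemma closed_walk_reversed m o s :
  closed_walk (reversed E) m o -> closed_walk E m (fun i => o (s - i)).
Proof.
move=> [per oE]; split=> i.
  by rewrite -[LHS]per; congr o; ring.
by have := oE (s - (i + 1)); rewrite opprD addrA subrK.
Qed.

Definition unroll (a : A) (p : seq A) (i : int) : A :=
  nth a (a :: p) `|(i %% size p)%Z|.

Lemma unroll_nat a p k : last a p = a -> (k <= size p)%N ->
  unroll a p k%:Z = nth a (a :: p) k.
Proof.
move=> pa; rewrite leq_eqVlt /unroll modz_nat => /orP[/eqP->|kp].
  by rewrite modnn /= -[RHS]/(nth a (a :: p) (size (a :: p)).-1) nth_last.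
by rewrite modn_small.
Qed.

Lemma closed_walk_unroll a p : path E a p -> last a p = a -> (0 < size p)%N ->
  closed_walk E (size p) (unroll a p).
Proof.
move=> /(pathP a) pP pa p0; split=> i; first by rewrite /unroll modzDr.
have [k kp ik] := int_residue i p0.
have unrollE j : unroll a p (i + j) = unroll a p (k%:Z + j).
  by rewrite /unroll -modzDml ik modzDml.
have -> : unroll a p i = unroll a p k%:Z by have := unrollE 0; rewrite !addr0.
by rewrite unrollE -PoszD addn1 !unroll_nat ?pP // ltnW.
Qed.

Lemma closed_walk_through k l a b :
    walk E k a b -> walk E l b a -> (0 < k + l)%N ->
  exists2 o, closed_walk E (k + l) o & o 0 = a /\ o k%:Z = b.
Proof.
move=> [p [pP pk <-]] [p' [pP' pl pa]] kl0; have skl : size (p ++ p') = (k + l)%N.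
  by rewrite size_cat pk pl.
have last_a : last a (p ++ p') = a by rewrite last_cat.
exists (unroll a (p ++ p')).
  by rewrite -skl; apply: closed_walk_unroll; rewrite ?cat_path ?pP ?skl.
rewrite -[0]/(0%:Z) !unroll_nat ?skl ?leq_addr //; split=> //.
by rewrite -cat_cons nth_cat /= pk ltnS leqnn -pk; exact: (nth_last a (a :: p)).
Qed.

Lemma closed_walk_cyclic m o i : (0 < m)%N -> closed_walk E m o ->
  exists k, walk E k.+1 (o i) (o i).
Proof.
move=> m0 [per oE]; exists m.-1; rewrite prednK // -{2}per.
elim: m {m0 per} => [|m IH]; first by rewrite addr0; apply/walk0.
by apply: walk_rcons IH _; rewrite -addn1 PoszD addrA.
Qed.

(* With e -> a, e -> a', a' -> b but not a -> b, o runs first through the loop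
   e a' b .. e and then through e a .. e, and f in the opposite order. *)
Lemma crossed_closed_walks (S : set A) :
    strong_component E S -> ~ siblings_share_successors E S ->
  exists2 L, (0 < L)%N & forall m, (L %| m)%N -> (0 < m)%N ->
    exists o f, [/\ closed_walk E m o, closed_walk E m f, ~~ E (f 0) (o 1) &
      forall d : nat, (L <= d < m)%N -> f d%:Z = o d%:Z].
Proof.
move=> [conn _] nsib.
have [e [a [a' [b [[Se Sa Sa' Sb] ea ea' a'b ab]]]]] : exists e a a' b,
    [/\ [/\ S e, S a, S a' & S b], E e a, E e a', E a' b & ~~ E a b].
  apply: contrapT => no; apply: nsib => e a' a b Se Sa' Sa Sb ea' ea a'b.
  by apply/negPn/negP => ab; apply: no; exists e, a, a', b.
have [k1 [r1 [r1P s1 r1e]]] := conn b e Sb Se.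
have [k2 [r2 [r2P s2 r2e]]] := conn a e Sa Se.
pose p1 := [:: a', b & r1]; pose p2 := a :: r2; pose L := size (p1 ++ p2).
exists L => // m Lm m0; have Lm' := dvdn_leq m0 Lm.
have p12 : path E e (p1 ++ p2) /\ last e (p1 ++ p2) = e.
  by rewrite cat_path last_cat /= ea' a'b r1P r1e ea r2P.
have p21 : path E e (p2 ++ p1) /\ last e (p2 ++ p1) = e.
  by rewrite cat_path last_cat /= ea r2P r2e ea' a'b r1P.
have [p [pP sp pe]] : walk E (m - L) e e.
  have /dvdnP[k ->] : (L %| m - L)%N by rewrite dvdn_subl // dvdnn.
  by apply: walk_iter; exists (p1 ++ p2); case: p12.
have closed s : size s = L -> path E e s /\ last e s = e ->
    closed_walk E m (unroll e (s ++ p)).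
  move=> sL [sP se]; have sz : size (s ++ p) = m by rewrite size_cat sL sp subnKC.
  by rewrite -sz; apply: closed_walk_unroll; rewrite ?cat_path ?last_cat ?sP ?se ?pe ?sz.
have s21 : size (p2 ++ p1) = L by rewrite /L !size_cat addnC.
have unrollE s k : size s = L -> path E e s /\ last e s = e -> (k <= m)%N ->
    unroll e (s ++ p) k%:Z = nth e (e :: s ++ p) k.
  by move=> sL [sP se] km; rewrite unroll_nat ?last_cat ?se ?pe // size_cat sL sp subnKC.
have m2 : (2 <= m)%N by apply: leq_trans Lm'; rewrite /L size_cat /= s1.
exists (fun i => unroll e ((p1 ++ p2) ++ p) (i + 1)).
exists (fun i => unroll e ((p2 ++ p1) ++ p) (i + 1)).
split; [exact/closed_walk_shift/closed|exact/closed_walk_shift/closed| |].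
  by rewrite add0r !(unrollE _ 1) ?(unrollE _ 2).
move=> d /andP[Ld dm].
have tail s : size s = L -> nth e (e :: s ++ p) d.+1 = nth e p (d - L).
  by move=> sL /=; rewrite nth_cat sL ltnNge Ld.
by rewrite -PoszD addn1 !unrollE // !tail.
Qed.

End ClosedWalks.

Lemma crossed_closed_walks_agreeing (A : finType) (E : rel A) (S : set A) :
    strong_component E S -> ~ siblings_share_successors E S ->
  exists2 L, (0 < L)%N & forall m d, (L %| m)%N -> (1 < d < m)%N ->
    exists o f, [/\ closed_walk E m o, closed_walk E m f, ~~ E (f 0) (o 1) &
      f d%:Z = o d%:Z].
Proof.
move=> comp nsib; have [La La0 late] := crossed_closed_walks comp nsib.
have nsib' : ~ siblings_share_successors (reversed E) S.
  by move=> sib; apply/nsib/(siblings_share_successors_reversed comp).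
have [Lb Lb0 early] := crossed_closed_walks (strong_component_reversed comp) nsib'.
exists (La * (Lb * (La + Lb)))%N => [|m d Lm /andP[d1 dm]].
  by rewrite !muln_gt0 La0 Lb0 addn_gt0 La0.
have m0 : (0 < m)%N by lia.
have [dLa|Lad] := ltnP d La; last first.
  have [|o [f [co cf nE agree]]] := late m _ m0; first exact: dvdn_trans (dvdn_mulr _ _) Lm.
  by exists o, f; split=> //; apply: agree; rewrite Lad.
have Lbm : (Lb %| m)%N.
  by apply: dvdn_trans Lm; rewrite mulnCA dvdn_mulr.
have mL : (La + Lb <= m)%N.
  by apply: dvdn_leq => //; apply: dvdn_trans Lm; rewrite mulnA dvdn_mull.
have [o [f [co cf nE agree]]] := early m Lbm m0.
exists (fun i => f (1 - i)), (fun i => o (1 - i)).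
split; [exact: closed_walk_reversed|exact: closed_walk_reversed|by rewrite subrr subr0|].
have [[po _] [pf _]] := (co, cf).
have -> : 1 - d%:Z = (m + 1 - d)%N%:Z + (- 1) * m%:Z by lia.
by rewrite !periodic_mul // agree //; lia.
Qed.

Lemma separating_closed_walks (A : finType) (E : rel A) :
  ~ condition_D (fun a b => E a b) -> exists2 m, (2 < m)%N &
  (forall d : int, ~~ (m %| d - 1)%Z ->
     exists2 o, closed_walk E m o & ~~ E (o 0) (o d)) /\
  (forall d : int, ~~ (m %| d)%Z -> ~~ (m %| d - 1)%Z ->
     exists o f, [/\ closed_walk E m o, closed_walk E m f, ~~ E (f 0) (o 1) &
       f d = o d]).
Proof.
move=> nD; have [M M0 chordless] := chordless_closed_walks nD.
have [_ _ [S [comp nsib]]] := not_condition_D_witnesses nD.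
have [L L0 crossed] := crossed_closed_walks_agreeing comp nsib.
pose m := (M * (L * 3))%N; have m0 : (0 < m)%N by rewrite !muln_gt0 M0 L0.
have Mm : (M %| m)%N by rewrite dvdn_mulr.
have Lm : (L %| m)%N by rewrite /m mulnCA dvdn_mulr.
have m3 : (2 < m)%N by apply: dvdn_leq m0 _; rewrite /m mulnA dvdn_mull.
exists m => //; split=> d; have [k km dk] := int_residue d m0.
  rewrite -eqz_mod_dvd dk => d1; have k1 : k != 1%N by apply: contra d1 => /eqP->.
  have [a [b [ab ba nab]]] := chordless m k Mm km k1.
  have [|o co [o0 ok]] := closed_walk_through ab ba; first by rewrite subnKC ?(ltnW km).
  rewrite subnKC in co; last exact: ltnW.
  by exists o => //; have [po _] := co; rewrite (eq_periodic po dk) o0 ok.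
rewrite -[d in (_ %| d)%Z]subr0 -!eqz_mod_dvd dk => d0 d1.
have k1 : (1 < k < m)%N.
  by rewrite km andbT; case: k {km dk} d0 d1 => [|[|]] //; rewrite eqxx.
have [o [f [co cf nE agree]]] := crossed m k Lm k1.
exists o, f; split=> //; have [[po _] [pf _]] := (co, cf).
by rewrite (eq_periodic po dk) (eq_periodic pf dk).
Qed.

(** * Transmission tables *)

(* F r i t is the letter at height r of the block that a column of type i
   carrying the tile t shows. *)
Record transmission_table (A T : Type) (E : rel A) (m n : nat)
    (overlap : T -> T -> Prop) (F : int -> int -> T -> A) : Prop := {
  table_periodic_height : forall i t, periodic n (fun r => F r i t);
  table_periodic_type : forall r t, periodic m (fun i => F r i t);
  table_synchronizes : forall i j psi,
    ~~ ((m %| j - (i + 1))%Z && (n %| psi)%Z) ->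
    exists r, forall t t', ~~ E (F r i t) (F (r + psi) j t');
  table_transmits : forall i t t',
    (forall r, E (F r i t) (F r (i + 1) t')) <->
    (if (m %| i + 1)%Z then overlap t t' else t = t')
}.

Lemma eq_transmission_table (A T : Type) (E E' : rel A) m n overlap
    (F : int -> int -> T -> A) :
    (forall r i t r' i' t', E (F r i t) (F r' i' t') = E' (F r i t) (F r' i' t')) ->
  transmission_table E m n overlap F -> transmission_table E' m n overlap F.
Proof.
move=> EE' [pn pm sync trans]; split=> // [i j psi /sync[r nE]|i t t'].
  by exists r => t t'; rewrite -EE'.
rewrite -trans; by split=> edge r; have := edge r; rewrite EE'.
Qed.

Lemma separating_pairs (A : finType) (E : rel A) :
  ~ condition_D (fun a b => E a b) -> exists2 m, (2 < m)%N &
  forall i j s : int, ~~ (m %| s - i)%Z -> ~~ (m %| s - (i + 1))%Z ->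
  exists W : bool -> int -> A,
    [/\ forall b, closed_walk E m (W b), ~~ E (W true i) (W false j),
        W true s = W false s & ~~ (m %| j - (i + 1))%Z -> W true = W false].
Proof.
move=> /separating_closed_walks[m m2 [single pair]]; exists m => // i j s si si1.
have [ji|ji] := boolP (m %| j - (i + 1))%Z; last first.
  have [|o co nE] := single (j - i); first by rewrite -addrA -opprD.
  exists (fun _ x => o (x - i)); split=> // [_|]; first exact: closed_walk_shift.
  by rewrite subrr.
have [|o [f [co cf nE agree]]] := pair (s - i) si; first by rewrite -addrA -opprD.
exists (fun b x => if b then f (x - i) else o (x - i)); split=> //=.
- by case; exact: closed_walk_shift.
- rewrite subrr; have [po _] := co.
  rewrite (eq_periodic (j := 1) po) //; apply/eqP.
  by rewrite eqz_mod_dvd -addrA -opprD.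
Qed.

Section Rows.
Variables (A T : finType) (C : eqType) (E : rel A) (m : nat).
Variables (right left : T -> C) (W : 'I_m -> int -> bool -> int -> A).

(* The row that detects a tile at p passes from one of its two walks to the
   other in the step from type -1 to type 0 or, when p = m - 1, in the step from
   -2 to -1; the walks have to agree at one end of that step. *)
Definition switch (p : 'I_m) : int :=
  if p.+1 == m then - 2%:Z else if p.+2 == m then 0 else - 1%:Z.

Hypothesis m2 : (2 < m)%N.

Lemma switch_off (p : 'I_m) :
  ~~ (m %| switch p - p%:Z)%Z && ~~ (m %| switch p - (p%:Z + 1))%Z.
Proof.
have pm := ltn_ord p; rewrite /switch; have [p1|p1] := eqVneq p.+1 m.
  have -> : - 2%:Z - p%:Z = - 1 + (- 1) * m%:Z by lia.
  have -> : - 2%:Z - (p%:Z + 1) = - 2%:Z + (- 1) * m%:Z by lia.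
  by rewrite !rpredDr ?dvdz_mull // !dvdz_small; lia.
by case: eqVneq => p2; rewrite !dvdz_small; lia.
Qed.

Hypothesis W_closed : forall (p : 'I_m) j b, closed_walk E m (W p j b).
Hypothesis W_separates : forall (p : 'I_m) j, ~~ E (W p j true p) (W p j false j).
Hypothesis W_switch : forall (p : 'I_m) j,
  W p j true (switch p) = W p j false (switch p).
Hypothesis W_single : forall (p : 'I_m) j,
  ~~ (m %| j - (p%:Z + 1))%Z -> W p j true = W p j false.

Definition marked (p : 'I_m) (t1 : T) (i : int) (t : T) : bool :=
  if p.+1 == m then
    if (m %| i + 1)%Z then right t == right t1 else left t == right t1
  else t == t1.

(* The rows of the first kind separate types that do not follow each other,
   those of the second kind detect at p the tile t1, or only its right part
   when p = m - 1. *)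
Definition row_label : finType :=
  (('I_m * 'I_m * bool) + ('I_m * T))%type.

Definition table_row (k : row_label) (i : int) (t : T) : A :=
  match k with
  | inl (p, q, b) => W p q b i
  | inr (p, t1) => W p (p%:Z + 1) (marked p t1 i t) i
  end.

Lemma ord_residue (i : int) : exists p : 'I_m, (i = p%:Z %[mod m])%Z.
Proof.
have [|k km ik] := @int_residue m i; first by lia.
by exists (Ordinal km).
Qed.

Lemma table_row_periodic k t : periodic m (fun i => table_row k i t).
Proof.
move=> i; case: k => [[[p q] b]|[p t1]] /=; first by have [-> _] := W_closed p q b.
have -> : marked p t1 (i + m%:Z) t = marked p t1 i t.
  by rewrite /marked addrAC rpredDr ?dvdzz.
by have [-> _] := W_closed p (p%:Z + 1) (marked p t1 i t).
Qed.

Lemma table_row_on_cycle k i t :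
  exists l, walk E l.+1 (table_row k i t) (table_row k i t).
Proof.
have m0 : (0 < m)%N by lia.
by case: k => [[[p q] b]|[p t1]] /=; apply: closed_walk_cyclic (W_closed _ _ _).
Qed.

Lemma walk_switch (p : 'I_m) j b b' i :
    (b = b') \/ (m %| i - switch p)%Z \/ (m %| i + 1 - switch p)%Z ->
  E (W p j b i) (W p j b' (i + 1)).
Proof.
have at_switch x : (m %| x - switch p)%Z -> W p j b x = W p j b' x.
  have [[per_b _] [per_b' _]] := (W_closed p j b, W_closed p j b').
  rewrite -eqz_mod_dvd => /eqP e; rewrite (eq_periodic per_b e) (eq_periodic per_b' e).
  by case: b b' {per_b per_b'} => -[]; rewrite ?W_switch.
have [[_ Eb] [_ Eb']] := (W_closed p j b, W_closed p j b').
by case=> [<-//|[/at_switch->//|/at_switch <-//]].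
Qed.

Lemma table_row_transmits k i t t' :
    (if (m %| i + 1)%Z then right t = left t' else t = t') ->
  E (table_row k i t) (table_row k (i + 1) t').
Proof.
case: k => [[[p q] b]|[p t1]] /=; first by have [_] := W_closed p q b.
move=> rel_tt'; apply: walk_switch; move: rel_tt'; rewrite /marked /switch.
have [_|_] := eqVneq p.+1 m; have [i1|i1] := boolP (m %| i + 1)%Z.
- by move=> ->; left; rewrite rpredDl // dvdz_small //; lia.
- move=> ->; have [i2|i2] := boolP (m %| i + 1 + 1)%Z; last by left.
  by right; left; rewrite opprK (_ : i + 2%:Z = i + 1 + 1) //; lia.
- by move=> _; right; case: eqP => _; [right; rewrite subr0|left; rewrite opprK].
- by move=> ->; left.
Qed.

Lemma table_row_detects i t t' :
    (forall k, E (table_row k i t) (table_row k (i + 1) t')) ->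
  if (m %| i + 1)%Z then right t = left t' else t = t'.
Proof.
have [p ip] := ord_residue i => /(_ (inr (p, t))) /=.
have dvdD c : (m %| i + c)%Z = (m %| p%:Z + c)%Z.
  by apply: eq_mod_dvdz; rewrite -modzDml ip modzDml.
have marked_t : marked p t i t.
  by rewrite /marked !eqxx dvdD dvdz_succ_small //; case: eqP.
rewrite marked_t; have [next|other] := boolP (marked p t (i + 1) t').
  move=> _; move: next; rewrite /marked -addrA !dvdD -dvdz_succ_small //.
  have [p1|_] := boolP (m %| p%:Z + 1)%Z; last by move=> /eqP->.
  by rewrite addrA rpredDl // dvdz_small; [move=> /eqP->|lia].
have [per_t _] := W_closed p (p%:Z + 1) true.
have [per_f _] := W_closed p (p%:Z + 1) false.
rewrite (eq_periodic per_t ip) (eq_periodic (j := p%:Z + 1) per_f).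
  by rewrite (negbTE (W_separates _ _)).
by rewrite -modzDml ip modzDml.
Qed.

Lemma transmission_table_rows n (w : int -> row_label) : (1 < n)%N -> periodic n w ->
    (forall psi, ~~ (n %| psi)%Z ->
       forall k l, exists r, w r = k /\ w (r + psi) = l) ->
  transmission_table E m n (fun t t' => right t = left t') (fun r => table_row (w r)).
Proof.
move=> n1 per_w pairs; have n_ndvd1 : ~~ (n %| 1)%Z by rewrite dvdz1 gtn_eqF.
split=> [i t r|r t|i j psi ne|i t t'].
- by rewrite per_w.
- exact: table_row_periodic.
- have [[p ip] [q jq]] := (ord_residue i, ord_residue j).
  have W_ij b b' : E (W p q b i) (W p q b' j) = E (W p q b p) (W p q b' q).
    have [[per_b _] [per_b' _]] := (W_closed p q b, W_closed p q b').
    by rewrite (eq_periodic per_b ip) (eq_periodic per_b' jq).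
  have [psi0|psi0] := boolP (n %| psi)%Z; last first.
    have [r [wr wr']] := pairs psi psi0 (inl (p, q, true)) (inl (p, q, false)).
    by exists r => t t'; rewrite wr wr' /= W_ij.
  have [r [wr _]] := pairs 1 n_ndvd1 (inl (p, q, true)) (inl (p, q, true)).
  exists r => t t'; have -> : w (r + psi) = w r.
    by apply: eq_periodic per_w _; apply/eqP; rewrite eqz_mod_dvd addrC addKr.
  rewrite wr /= W_ij {2}W_single //.
  move: ne; rewrite psi0 andbT -!eqz_mod_dvd jq => ne.
  by apply: contra ne => /eqP->; rewrite -modzDml -ip modzDml.
- split=> [edge|rel_tt' r]; last exact: table_row_transmits.
  apply: table_row_detects => k.
  by have [r [<- _]] := pairs 1 n_ndvd1 k k.
Qed.

End Rows.

Lemma transmission_table_exists (A T : finType) (C : eqType) (E : rel A)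
    (right left : T -> C) : ~ condition_D (fun a b => E a b) ->
  exists m n F, [/\ (1 < m)%N, (0 < n)%N,
    transmission_table E m n (fun t t' => right t = left t') F &
    forall r i t, exists k, walk E k.+1 (F r i t) (F r i t)].
Proof.
move=> /separating_pairs[m m2 pairs].
have /choice[W WP] (pj : 'I_m * int) : exists W : bool -> int -> A,
    [/\ forall b, closed_walk E m (W b), ~~ E (W true pj.1) (W false pj.2),
      W true (switch pj.1) = W false (switch pj.1) &
      ~~ (m %| pj.2 - (pj.1%:Z + 1))%Z -> W true = W false].
  by case: pj => p j; apply: pairs; case/andP: (switch_off m2 p).
have m0 : (0 < m)%N by lia.
have [n [w [n1 per_w w_pairs]]] :=
  all_pairs_at_all_shifts (inl (Ordinal m0, Ordinal m0, true) : row_label T m).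
pose W' p j := W (p, j).
have W'_closed p j b : closed_walk E m (W' p j b).
  by case: (WP (p, j)) => closed _ _ _; apply: closed.
exists m, n, (fun r => table_row right left W' (w r)); split.
- exact: ltnW.
- exact: ltnW.
- by apply: transmission_table_rows => // p j; have [] := WP (p, j).
- by move=> r i t; apply: table_row_on_cycle.
Qed.

(** * Configurations, shifts and locally determined sets and maps *)

Local Open Scope classical_set_scope.

Lemma pair_addE (U V : nmodType) (a c : U) (b d : V) :
  (a, b) + (c, d) = (a + c, b + d).
Proof. by []. Qed.

Lemma shift2D (A : finType) (u v : int * int) (x : conf2 A) :
  shift2 u (shift2 v x) = shift2 (u + v) x.
Proof. by apply/funext => k; rewrite /shift2 opprD addrA. Qed.

Lemma shift2_0 (A : finType) (x : conf2 A) : shift2 0 x = x.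
Proof. by apply/funext => k; rewrite /shift2 subr0. Qed.

Lemma sft2_shift (B : finType) (F : seq (pattern B)) v y :
  sft2 F y -> sft2 F (shift2 v y).
Proof.
move=> Fy p u pF py; apply: (Fy p (u - v) pF) => c cp.
by rewrite -(py c cp) /shift2 addrAC.
Qed.

Definition shift_invariant (A : Type) (H : set (int -> A)) : Prop :=
  forall v x, H x -> H (fun i => x (i + v)).

Lemma combined_shift (A : finType) (H V : set (int -> A)) v x :
    shift_invariant H -> shift_invariant V ->
  combined H V x -> combined H V (shift2 v x).
Proof.
case: v => v1 v2 invH invV Xx i j; split.
  exact: invH (- v1) _ (Xx i (j - v2)).1.
exact: invV (- v2) _ (Xx (i - v1) j).2.
Qed.

Section LocallyDetermined.
Variables (A : finType) (X : set (conf2 A)).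

Definition agree_on (s : seq (int * int)) (x x' : conf2 A) : Prop :=
  forall k, k \in s -> x' k = x k.

Lemma nbhs_agree_on s (x : set_type X) :
  nbhs x [set x' | agree_on s (set_val x) (set_val x')].
Proof.
apply: (@initial_continuous (set_type X) (conf2 A) set_val x
  [set x' | agree_on s (set_val x) x']).
elim: s => [|k s IH]; first by apply: filterS filterT.
have nbhs_k : nbhs (set_val x) [set x' : conf2 A | x' k = set_val x k].
  have := @proj_continuous _ (fun _ : int * int => discrete_topology A) k
    (set_val x) [set (set_val x k : discrete_topology A)].
  by apply; exact: discrete_set1.
by apply: filterS2 nbhs_k IH => x' xk xs j; rewrite inE => /orP[/eqP->|/xs].
Qed.

Definition locally_determined (P : set (set_type X)) : Prop :=
  exists s, forall z z' : set_type X,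
    agree_on s (set_val z) (set_val z') -> P z -> P z'.

Lemma locally_determined_open P : locally_determined P -> open P.
Proof.
move=> [s loc]; rewrite openE => z Pz.
by apply: filterS (nbhs_agree_on s z) => z' /loc; apply.
Qed.

Lemma locally_determined_clopen P : locally_determined P -> clopen P.
Proof.
move=> locP; split; first exact: locally_determined_open.
rewrite -openC; apply: locally_determined_open; have [s loc] := locP.
by exists s => z z' zz' nPz /loc Pz; apply/nPz/Pz => k /zz'.
Qed.

Lemma locally_determined_continuous (B : finType) (Y : set (conf2 B))
    (f : set_type X -> set_type Y) :
    (forall k, exists s, forall z z' : set_type X,
       agree_on s (set_val z) (set_val z') -> set_val (f z') k = set_val (f z) k) ->
  continuous f.
Proof.
move=> loc; apply: (@continuous_comp_initial _ _ _ (set_val : set_type Y -> conf2 B)).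
move=> z; apply/cvg_sup; first exact/fmap_filter/(nbhs_filter z).
move=> k U [_ [[V oV <-]] /= Vz] VU; have [s locs] := loc k.
apply: (@filterS _ (nbhs z) _ _ _ _ (nbhs_agree_on s z)) => z' /locs fk /=.
by apply: VU; rewrite /= fk.
Qed.

End LocallyDetermined.

(** * A transmission table makes the combined subshift a root *)

Definition biinfinite_walks (A : finType) (E : rel A) : set (int -> A) :=
  [set x | forall i, E (x i) (x (i + 1))].

Lemma biinfinite_walks_shift (A : finType) (E : rel A) :
  shift_invariant (biinfinite_walks E).
Proof. by move=> v x walk_x i; rewrite addrAC. Qed.

Lemma divz_mulD n (q : int) r : (r < n)%N -> ((q * n%:Z + r%:Z) %/ n)%Z = q.
Proof. by move=> rn; rewrite divzMDl ?divz_small ?addr0 //; lia. Qed.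

Lemma divz_succ n (i : int) : (0 < n)%N ->
  ((i + 1) %/ n)%Z = (i %/ n)%Z + (n %| i + 1)%Z%:Z.
Proof.
move=> n0; have [r rn ir] := int_residue i n0.
have iE : i = (i %/ n)%Z * n%:Z + r%:Z.
  by rewrite [LHS](divz_eq i n) ir modz_small.
have dvd_r : (n %| i + 1)%Z = (r.+1 == n).
  by rewrite {1}iE -addrA rpredDl ?dvdz_mull // dvdz_succ_small.
rewrite dvd_r {1}iE -addrA -PoszD addn1; case: eqP => [->|ne].
  by rewrite divzMDl ?divzz ?lt0n_neq0 //; lia.
by rewrite divz_mulD ?addr0 //; lia.
Qed.

Lemma neighbouring_height (y : nat) (d : int) : -1 <= d <= 1 ->
  exists2 y' : nat, y'%:Z = (1 + y)%N%:Z - d & (y' <= y.+2)%N.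
Proof. by move=> d1; exists (absz ((1 + y)%N%:Z - d)); lia. Qed.

Section Root.
Variables (A B : finType) (E : rel A) (T : Type) (R : nat).
Variables (tile_letter : T -> nat -> B) (tile_of : (nat -> B) -> T).
Hypothesis tile_letter_of : forall s x, (x <= 2 * R)%N -> tile_letter (tile_of s) x = s x.
Hypothesis tile_letter_ext : forall t t',
  (forall x, (x <= 2 * R)%N -> tile_letter t x = tile_letter t' x) -> t = t'.
Variable FY : seq (pattern B).
Hypothesis FY_radius : forall p c, p \in FY -> c \in p ->
  (absz c.1.1 <= R)%N /\ (absz c.1.2 <= R)%N.

Definition overlap (t t' : T) : Prop :=
  forall x, (x < 2 * R)%N -> tile_letter t x.+1 = tile_letter t' x.

Variables (m n : nat) (F : int -> int -> T -> A).
Hypotheses (m1 : (1 < m)%N) (n0 : (0 < n)%N).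
Hypothesis tableF : transmission_table E m n overlap F.

Let F_height i t r r' : (r = r' %[mod n])%Z -> F r i t = F r' i t.
Proof. exact: eq_periodic (table_periodic_height tableF i t). Qed.

Let F_type r t i i' : (i = i' %[mod m])%Z -> F r i t = F r i' t.
Proof. exact: eq_periodic (table_periodic_type tableF r t). Qed.

Lemma table_inj i t t' : (forall r, F r i t = F r i t') -> t = t'.
Proof.
move=> Ftt'; have [i1|i1] := boolP (m %| i + 1)%Z.
  have i0 : (m %| i - 1 + 1)%Z = false.
    apply/negP; rewrite subrK => i0.
    have : (m %| i + 1 - i)%Z by rewrite rpredB.
    by rewrite addrAC subrr add0r dvdz1; lia.
  have [_ edge] := table_transmits tableF (i - 1) t t.
  have [same _] := table_transmits tableF (i - 1) t t'.
  rewrite i0 subrK in edge same; apply: same => r; rewrite -Ftt'; exact: edge.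
have [_ edge] := table_transmits tableF i t t.
have [same _] := table_transmits tableF i t' t.
rewrite (negbTE i1) in edge same; apply/esym/same => r; rewrite -Ftt'; exact: edge.
Qed.

(* After a partial block a window contains 2 R + 1 full ones, enough to see any
   pattern of FY, and one more, which leaves room to compare two columns. *)
Definition window : nat := (2 * R + 3) * n.

Definition valid_stack (S : nat -> T) : Prop :=
  forall p, p \in FY -> ~ forall c, c \in p ->
    tile_letter (S (absz (R%:Z + c.1.2)).+1) (absz (R%:Z + c.1.1)) = c.2.

Lemma eq_valid_stack S S' :
  (forall k, (k <= 2 * R + 1)%N -> S k = S' k) -> valid_stack S -> valid_stack S'.
Proof.
move=> SS' valid p pF pS'; apply: (valid p pF) => c cp.
by have [_ c2] := FY_radius pF cp; rewrite SS' ?pS' //; lia.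
Qed.

(* The letters u 0, u 1, ... are those of a stack of blocks of type j, u 0
   being at height phi in the block of the tile S 0. *)
Definition reads (u : nat -> A) (j : int) (phi : nat) (S : nat -> T) : Prop :=
  [/\ (phi < n)%N, valid_stack S &
      forall y, (y < window)%N -> u y = F (y + phi)%N j (S ((y + phi) %/ n)%N)].

Definition stack_columns : set (int -> A) :=
  [set x | forall y0 : int, exists j phi S, reads (fun y => x (y0 + y%:Z)) j phi S].

Let X := combined (biinfinite_walks E) stack_columns.
Let Y := sft2 FY.
Let m0 : (0 < m)%N. Proof. exact: ltnW. Qed.

Definition tile_at (y : conf2 B) (a b : int) : T :=
  tile_of (fun x => y (a + x%:Z - R%:Z, b)).

Definition encode (y : conf2 B) : conf2 A := fun k =>
  F k.2 k.1 (tile_at y (k.1 %/ m)%Z (k.2 %/ n)%Z).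

Lemma valid_tile_at y a b : Y y -> valid_stack (fun k => tile_at y a (b + k%:Z)).
Proof.
move=> Yy p pF py; apply: (Yy p (a, b + 1 + R%:Z) pF) => c cp.
have [c1 c2] := FY_radius pF cp; rewrite -(py c cp) tile_letter_of; last by lia.
by case: c c1 c2 {cp} => -[c1 c2] l /= *; rewrite pair_addE; congr (y (_, _)); lia.
Qed.

Lemma encode_reads y c y0 : Y y ->
  reads (fun k => encode y (c, y0 + k%:Z)) c (absz (y0 %% n)%Z)
    (fun k => tile_at y (c %/ m)%Z ((y0 %/ n)%Z + k%:Z)).
Proof.
move=> Yy; have y0_mod : (y0 %% n)%Z = (absz (y0 %% n)%Z)%:Z.
  by rewrite gez0_abs // modz_ge0 //; lia.
have phin : (absz (y0 %% n)%Z < n)%N.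
  by rewrite -ltz_nat -y0_mod ltz_pmod.
split=> // [|k _]; first exact: valid_tile_at.
have y0k : y0 + k%:Z = (y0 %/ n)%Z * n%:Z + (k + absz (y0 %% n)%Z)%N%:Z.
  by rewrite {1}(divz_eq y0 n) {1}y0_mod PoszD; ring.
rewrite /encode /= y0k divzMDl ?divz_nat; last by lia.
by apply: F_height; rewrite modzMDl.
Qed.

Lemma encode_combined y : Y y -> X (encode y).
Proof.
move=> Yy i j; split=> [c|y0]; last by do 3 eexists; exact: encode_reads.
rewrite /encode /=; apply: (table_transmits tableF c _ _).2.
rewrite divz_succ //; have [_|_] := boolP (m %| c + 1)%Z; last by rewrite addr0.
move=> x xR; rewrite !tile_letter_of; try lia.
by congr (y (_, _)); lia.
Qed.

Lemma encode_determines y y' a b :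
    (forall r : nat, (r < n)%N ->
       encode y (a * m%:Z, b * n%:Z + r%:Z) = encode y' (a * m%:Z, b * n%:Z + r%:Z)) ->
  y (a, b) = y' (a, b).
Proof.
move=> yy'; have tt' : tile_at y a b = tile_at y' a b.
  apply: (@table_inj (a * m%:Z)) => r; have [r' r'n rr'] := int_residue r n0.
  have := yy' r' r'n; rewrite /encode /= divz_mulD // mulzK; last by lia.
  by rewrite !(F_height _ _ (r' := r)) // modzMDl rr'.
have := congr1 (fun t => tile_letter t R) tt'; rewrite !tile_letter_of; try lia.
by rewrite addrK.
Qed.

Lemma encode_inj : injective encode.
Proof.
move=> y y' yy'; apply/funext => -[a b].
by apply: encode_determines => r _; rewrite yy'.
Qed.

Lemma encode_shift k1 k2 y :
  encode (shift2 (k1, k2) y) = shift2 (k1 * m%:Z, k2 * n%:Z) (encode y).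
Proof.
apply/funext => -[a b]; rewrite /encode /shift2 /=.
rewrite -!mulNr -![_ + - _ * _]addrC !divzMDl; try lia.
rewrite (F_height _ _ (r' := b)) ?modzMDl // (F_type _ _ (i' := a)) ?modzMDl //.
by congr (F _ _ (tile_of _)); apply/funext => x; congr (y (_, _)) => /=; lia.
Qed.

Definition read_as (x : conf2 A) (c y0 j : int) (phi : nat) : Prop :=
  exists S, reads (fun y => x (c, y0 + y%:Z)) j phi S.

Definition read_offset (c y0 j : int) (phi : nat) : int * int :=
  (((j - c) %% m)%Z, ((phi%:Z - y0) %% n)%Z).

Lemma read_exists x c y0 : X x -> exists j phi, read_as x c y0 j phi.
Proof. by move=> /(_ c 0)[_ /(_ y0)[j [phi [S xS]]]]; exists j, phi, S. Qed.

Lemma read_offset_next x c y0 (d : int) j phi j' phi' : X x -> -1 <= d <= 1 ->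
    read_as x c y0 j phi -> read_as x (c + 1) (y0 + d) j' phi' ->
  read_offset (c + 1) (y0 + d) j' phi' = read_offset c y0 j phi.
Proof.
move=> Xx d1 [S [phin _ xS]] [S' [phin' _ xS']].
pose psi := phi'%:Z - phi%:Z - d.
have [/andP[type_ok phase_ok]|ne] := boolP ((m %| j' - (j + 1))%Z && (n %| psi)%Z).
  congr pair; apply/eqP; rewrite eqz_mod_dvd.
    by rewrite (_ : _ - _ = j' - (j + 1)) //; ring.
  by rewrite (_ : _ - _ = psi) // /psi; ring.
have [r nE] := table_synchronizes tableF ne.
have [y1 y1n ry1] := int_residue (r - phi%:Z - 1) n0.
have wn : (3 * n <= window)%N by rewrite leq_mul2r; lia.
have yr : (r = (1 + y1 + phi)%N%:Z %[mod n])%Z.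
  apply/eqP; rewrite eqz_mod_dvd.
  rewrite (_ : _ - _ = r - phi%:Z - 1 - y1%:Z) -?eqz_mod_dvd ?ry1 //.
  by rewrite !PoszD; ring.
have [y2 y2E y2_le] := neighbouring_height y1 d1.
have in_window y : (y <= y1.+2)%N -> (y < window)%N.
  by move=> y_le; apply: leq_trans wn; clear -y_le y1n; lia.
have /= x1 := xS _ (in_window (1 + y1)%N (leqnSn _)).
have /= x2 := xS' _ (in_window y2 y2_le).
have height1 t : F (1 + y1 + phi)%N j t = F r j t by exact/esym/F_height.
have height2 t : F (y2 + phi')%N j' t = F (r + psi) j' t.
  apply: F_height; rewrite (_ : (y2 + phi')%N%:Z = (1 + y1 + phi)%N%:Z + psi).
    by rewrite -modzDml -yr modzDml.
  by rewrite !PoszD y2E /psi PoszD; ring.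
have := (Xx 0 (y0 + (1 + y1)%N%:Z)).1 c.
rewrite x1 (_ : y0 + (1 + y1)%N%:Z = y0 + d + y2%:Z) ?x2; last by rewrite y2E; ring.
by rewrite height1 height2 (negbTE (nE _ _)).
Qed.

Lemma read_offset_same_column x c y0 (d : int) j phi j' phi' : X x -> -1 <= d <= 1 ->
    read_as x c y0 j phi -> read_as x c (y0 + d) j' phi' ->
  read_offset c (y0 + d) j' phi' = read_offset c y0 j phi.
Proof.
move=> Xx d1 r1 r2; have [j3 [phi3 r3]] := read_exists (c + 1) y0 Xx.
have r30 : read_as x (c + 1) (y0 + 0) j3 phi3 by rewrite addr0.
have r3d : read_as x (c + 1) (y0 + d - d) j3 phi3 by rewrite addrK.
have <- := read_offset_next Xx _ r1 r30; last by [].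
have <- := read_offset_next Xx _ r2 r3d; last by lia.
by rewrite addrK addr0.
Qed.

Lemma read_offset_const x c y0 j phi c' y0' j' phi' : X x ->
    read_as x c y0 j phi -> read_as x c' y0' j' phi' ->
  read_offset c' y0' j' phi' = read_offset c y0 j phi.
Proof.
move=> Xx r r'; have /choice[rd rdP] (p : int * int) : exists jphi : int * nat,
    read_as x p.1 p.2 jphi.1 jphi.2.
  by have [i [psi ri]] := read_exists p.1 p.2 Xx; exists (i, psi).
pose off a b := read_offset a b (rd (a, b)).1 (rd (a, b)).2.
have offE a b i psi : read_as x a b i psi -> read_offset a b i psi = off a b.
  move=> ri; have := read_offset_same_column (d := 0) Xx isT (rdP (a, b)).
  by rewrite addr0; apply.
have per_b a : periodic 1 (off a).
  by move=> b; apply: read_offset_same_column (rdP (a, b)) (rdP (a, b + 1)).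
have per_a : periodic 1 (off^~ 0).
  move=> a; have := @read_offset_next x a 0 0 _ _ _ _ Xx isT (rdP (a, 0)).
  by rewrite addr0; apply; exact: rdP.
have off0 a b : off a b = off 0 0.
  have := periodic_mul 0 b (per_b a); have := periodic_mul 0 a (per_a).
  by rewrite !mulr1 !add0r => <-.
by rewrite !offE // off0 [RHS]off0.
Qed.

Lemma read_as_offset x c y0 j phi c' y0' j' phi' : X x -> (phi' < n)%N ->
    read_as x c y0 j phi -> read_offset c' y0' j' phi' = read_offset c y0 j phi ->
  read_as x c' y0' j' phi'.
Proof.
move=> Xx phin' r same; have [j1 [phi1 r1]] := read_exists c' y0' Xx.
have := read_offset_const Xx r r1; rewrite -same => -[/eqP e1 /eqP e2].
have [S [phi1n valid xS]] := r1; exists S.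
have <- : phi1 = phi'.
  by apply/eqP; move: e2; rewrite eqz_modDr !modz_nat !modn_small.
split=> // y /xS ->; apply: F_type; apply/eqP.
by move: e1; rewrite eqz_modDr.
Qed.

Definition aligned (x : conf2 A) : Prop := read_as x 0 0 0 0.

Lemma encode_aligned y : Y y -> aligned (encode y).
Proof. by move=> Yy; have := encode_reads 0 0 Yy; rewrite mod0z; eexists; eauto. Qed.

(* t c k is the tile that column c carries in the rows [k n, (k + 1) n). *)
Lemma aligned_tiles x : X x -> aligned x -> exists t : int -> int -> T,
  (forall c h, x (c, h) = F h c (t c (h %/ n)%Z)) /\
  (forall c k, valid_stack (fun s => t c (k + s%:Z))).
Proof.
move=> Xx al; have stack (p : int * int) : read_as x p.1 (p.2 * n%:Z) p.1 0.
  apply: (read_as_offset Xx n0 al).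
  by rewrite /read_offset !subrr sub0r -mulNr modzMl !mod0z.
have /choice[St StP] := stack.
pose t c k := St (c, k) 0%N.
have block c k s (r : nat) : (s <= 2 * R + 2)%N -> (r < n)%N ->
    x (c, (k + s%:Z) * n%:Z + r%:Z) = F r c (St (c, k) s).
  move=> sR rn; have [_ _ /(_ (s * n + r)%N)] := StP (c, k).
  rewrite /= addn0 divnMDl // divn_small // addn0 (F_height _ _ (r' := r)).
    rewrite PoszD PoszM mulrDl addrA; apply; rewrite /window; nia.
  by rewrite PoszD PoszM modzMDl.
have blocks c k s : (s <= 2 * R + 2)%N -> St (c, k) s = t c (k + s%:Z).
  move=> sR; apply: (@table_inj c) => h; have [r rn hr] := int_residue h n0.
  rewrite !(F_height _ _ hr) -block // -[in RHS](block c _ 0) //.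
  by rewrite addr0.
exists t; split=> [c h|c k]; last first.
  have [_ valid _] := StP (c, k); apply: eq_valid_stack valid => s sR.
  by apply: blocks; lia.
have [r rn hr] := int_residue h n0; rewrite (F_height _ _ hr).
have := block c (h %/ n)%Z 0%N r isT rn; rewrite addr0 => <-.
by rewrite {1}(divz_eq h n) hr modz_small.
Qed.

Lemma tiles_of_row (t : int -> T) :
    (forall c, if (m %| c + 1)%Z then overlap (t c) (t (c + 1)) else t c = t (c + 1)) ->
  exists z : int -> B, forall c,
    t c = tile_of (fun x => z ((c %/ m)%Z + x%:Z - R%:Z)).
Proof.
move=> tS; pose th a := t (a * m%:Z).
have t_th c : t c = th (c %/ m)%Z.
  have [r rm cr] := int_residue c m0.
  rewrite {1}(divz_eq c m) cr modz_small //; elim: r rm {cr} => [|r IH] rm.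
    by rewrite addr0.
  rewrite -IH; last exact: ltnW.
  have := tS ((c %/ m)%Z * m%:Z + r%:Z).
  rewrite -addrA rpredDl ?dvdz_mull // -PoszD addn1 dvdz_small; last by lia.
  by move=> ->.
have th_overlap a : overlap (th a) (th (a + 1)).
  have := tS ((a + 1) * m%:Z - 1); rewrite subrK dvdz_mull // t_th.
  have -> : (a + 1) * m%:Z - 1 = a * m%:Z + m.-1%:Z by rewrite mulrDl; lia.
  by rewrite divz_mulD ?prednK.
have th_shift a u d : (u + d <= 2 * R)%N ->
    tile_letter (th a) (u + d)%N = tile_letter (th (a + d%:Z)) u.
  elim: d a => [|d IH] a ud; first by rewrite addn0 addr0.
  rewrite addnS th_overlap ?IH; try lia.
  by congr (tile_letter (th _) _); lia.
exists (fun a => tile_letter (th a) R) => c; rewrite t_th.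
apply: tile_letter_ext => u uR; rewrite tile_letter_of //.
have [Ru|uR'] := leqP R u.
  have {1}-> : u = (R + (u - R))%N by lia.
  by rewrite th_shift; [congr (tile_letter (th _) _)|]; lia.
have {2}-> : R = (u + (R - u))%N by lia.
by rewrite th_shift; [congr (tile_letter (th _) _)|]; lia.
Qed.

Lemma aligned_encode x : X x -> aligned x -> exists2 y, Y y & encode y = x.
Proof.
move=> Xx al; have [t [xE valid]] := aligned_tiles Xx al.
have /choice[z tE] (k : int) : exists z : int -> B, forall c,
    t c k = tile_of (fun u => z ((c %/ m)%Z + u%:Z - R%:Z)).
  apply: (@tiles_of_row (t^~ k)) => c; apply/(table_transmits tableF) => r.
  have [r' r'n rr'] := int_residue r n0; rewrite !(F_height _ _ rr').
  have := (Xx 0 (k * n%:Z + r'%:Z)).1 c; rewrite !xE divz_mulD //.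
  by rewrite !(F_height _ _ (r := _ + _) (r' := r')) ?modzMDl.
pose y : conf2 B := fun p => z p.2 p.1.
have t_at c k : t c k = tile_at y (c %/ m)%Z k by rewrite tE.
exists y => [p v pF py|]; last by apply/funext => -[c h]; rewrite xE t_at.
apply: (valid (v.1 * m%:Z) (v.2 - R%:Z - 1) p pF) => c cp.
have [c1 c2] := FY_radius pF cp; rewrite t_at mulzK; last by lia.
rewrite tile_letter_of; last by lia.
rewrite -(py c cp); case: v c c1 c2 {py cp} => v1 v2 [[c1 c2] b] /= *.
by rewrite pair_addE; congr (y (_, _)); lia.
Qed.

Let Z : set (conf2 A) := encode @` Y.

Lemma encode_imageP x : Z x <-> X x /\ aligned x.
Proof.
split=> [[y Yy <-]|[Xx /(aligned_encode Xx)[y Yy <-]]]; last by exists y.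
by split; [exact: encode_combined|exact: encode_aligned].
Qed.

Lemma encode_image_clopen : clopen [set x : set_type X | Z (set_val x)].
Proof.
apply: locally_determined_clopen.
exists [seq (0 : int, Posz y) | y <- iota 0 window] => z z' zz'.
move=> /encode_imageP[_ [S [n0' valid zS]]]; apply/encode_imageP.
split; first exact: set_valP.
exists S; split=> // y yw; rewrite -zS //.
by rewrite zz' // !add0r; apply/mapP; exists y; rewrite // mem_iota.
Qed.

Lemma encode_image_shift k1 k2 : shift2 (k1 * m%:Z, k2 * n%:Z) @` Z = Z.
Proof.
have stable l1 l2 : shift2 (l1 * m%:Z, l2 * n%:Z) @` Z `<=` Z.
  move=> _ [_ [y Yy <-] <-]; exists (shift2 (l1, l2) y); first exact: sft2_shift.
  by rewrite encode_shift.
apply/seteqP; split=> [|z Zz]; first exact: stable.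
exists (shift2 (- k1 * m%:Z, - k2 * n%:Z) z); first by apply: stable; exists z.
by rewrite shift2D pair_addE !mulNr !subrr shift2_0.
Qed.

Lemma encode_homeomorphism : exists phi : set_type Z -> set_type Y,
  homeomorphism phi /\ forall z, encode (set_val (phi z)) = set_val z.
Proof.
have /choice[phi phiP] (z : set_type Z) : exists y : set_type Y,
    encode (set_val y) = set_val z.
  have [y Yy e] : Z (set_val z) by exact: set_valP.
  by exists (SigSub (mem_set Yy)).
have Z_encode (y : set_type Y) : Z (encode (set_val y)).
  by exists (set_val y) => //; exact: set_valP.
exists phi; split=> //; split.
  apply: locally_determined_continuous => -[a b].
  exists [seq (a * m%:Z, b * n%:Z + Posz r) | r <- iota 0 n] => z z' zz'.
  apply: encode_determines => r rn; rewrite !phiP zz' //.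
  by apply/mapP; exists r; rewrite // mem_iota.
exists (fun y => SigSub (mem_set (Z_encode y))); split.
- by move=> z; apply: val_inj; rewrite /= phiP.
- by move=> y; apply: val_inj; apply: encode_inj; rewrite phiP.
apply: locally_determined_continuous => -[a b].
exists [seq ((a %/ m)%Z + Posz x - R%:Z, (b %/ n)%Z) | x <- iota 0 (2 * R).+1].
move=> z z' zz'; rewrite /set_val /= /encode /=; congr (F _ _ _).
apply: tile_letter_ext => x xR; rewrite !tile_letter_of //; apply: zz'.
by apply/mapP; exists x; rewrite // mem_iota add0n ltnS.
Qed.

Lemma eq_reads u u' j phi S : u =1 u' -> reads u j phi S -> reads u' j phi S.
Proof. by move=> uu' [phin valid uS]; split=> // y yw; rewrite -uu' uS. Qed.

Lemma stack_columns_shift : shift_invariant stack_columns.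
Proof.
move=> v x Vx y0; have [j [phi [S xS]]] := Vx (y0 + v); exists j, phi, S.
by apply: eq_reads xS => y; rewrite addrAC.
Qed.

Lemma root_shift v x : X x -> X (shift2 v x).
Proof.
by apply: combined_shift; [exact: biinfinite_walks_shift|exact: stack_columns_shift].
Qed.

Lemma read_as_shift x v1 v2 c y0 j phi :
  read_as x (c - v1) (y0 - v2) j phi -> read_as (shift2 (v1, v2) x) c y0 j phi.
Proof. by move=> [S xS]; exists S; apply: eq_reads xS => y; rewrite addrAC. Qed.

Lemma translates_cover :
  X `<=` \bigcup_(ij : 'I_m * 'I_n) shift2 (ij.1%:Z, ij.2%:Z) @` Z.
Proof.
move=> x Xx; have [j [phi r]] := read_exists 0 0 Xx.
have [i1 i1m e1] := int_residue (- j) m0.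
have [i2 i2n e2] := int_residue (- phi%:Z) n0.
exists (Ordinal i1m, Ordinal i2n) => //=.
exists (shift2 (- i1%:Z, - i2%:Z) x); last first.
  by rewrite shift2D pair_addE !subrr shift2_0.
apply/encode_imageP; split; first exact: root_shift.
apply: read_as_shift; rewrite !opprK !add0r; apply: (read_as_offset Xx n0 r).
rewrite /read_offset !subr0 !sub0r -modzNm -e1 modzNm opprK.
by rewrite -[in LHS]modzNm -e2 modzNm opprK.
Qed.

Lemma translates_disjoint :
  trivIset setT (fun ij : 'I_m * 'I_n => shift2 (ij.1%:Z, ij.2%:Z) @` Z).
Proof.
have ord_eq p (i i' : 'I_p) : ((- i%:Z) %% p = (- i'%:Z) %% p)%Z -> i = i'.
  have [ip ip'] := (ltn_ord i, ltn_ord i'); move=> /eqP; rewrite eqz_mod_dvd opprK.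
  by rewrite dvdz_small => [/eqP ii'|]; [apply: val_inj => /=|]; lia.
move=> [i j] [i' j'] _ _ [x [[z /encode_imageP[Xz al] zx]]].
move=> [z' /encode_imageP[Xz' al'] z'x].
have Xx : X x by rewrite -zx; exact: root_shift.
have r : read_as x i%:Z j%:Z 0 0 by rewrite -zx; apply: read_as_shift; rewrite !subrr.
have r' : read_as x i'%:Z j'%:Z 0 0 by rewrite -z'x; apply: read_as_shift; rewrite !subrr.
have [] := read_offset_const Xx r r'; rewrite !sub0r => /ord_eq-> e.
by congr pair; apply/esym/ord_eq.
Qed.

Lemma root_of_transmission_table : is_root m n X Y.
Proof.
exists Z; split.
- by split; [move=> x /encode_imageP[]|exact: encode_image_clopen].
- have := encode_image_shift 1 0; have := encode_image_shift 0 1.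
  by rewrite !mul1r !mul0r.
- have [phi [homeo phiP]] := encode_homeomorphism; exists phi; split=> //.
  by move=> x x' k1 k2 e; apply: encode_inj; rewrite encode_shift !phiP.
split; last exact: translates_disjoint.
apply/seteqP; split=> [|x [ij _ [z /encode_imageP[Xz _] <-]]].
  exact: translates_cover.
exact: root_shift.
Qed.

End Root.

Local Close Scope classical_set_scope.
Local Close Scope ring_scope.

(** * Computable functions *)

Fixpoint unpair (z : nat) : nat * nat :=
  if z is z'.+1 then
    let p := unpair z' in if p.1 is x.+1 then (x, p.2.+1) else (p.2.+1, 0)
  else (0, 0).

Definition nfst z := (unpair z).1.
Definition nsnd z := (unpair z).2.

Lemma npairS x y : npair x y.+1 = (npair x.+1 y).+1.
Proof. by rewrite /npair addSnnS addnS. Qed.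

Lemma npair0 x : npair x.+1 0 = (npair 0 x).+1.
Proof. by rewrite /npair !addn0 add0n binS bin1; lia. Qed.

Lemma npairK z : npair (nfst z) (nsnd z) = z.
Proof.
rewrite /nfst /nsnd; elim: z => [|z] //=; case: (unpair z) => -[|x] y /= <-.
  exact: npair0.
exact: npairS.
Qed.

Lemma unpairK x y : unpair (npair x y) = (x, y).
Proof.
have [z zxy] : exists z, npair x y = z by exists (npair x y).
rewrite zxy; elim: z x y zxy => [|z IH] x [|y].
- by case: x => [|x] //; rewrite npair0.
- by rewrite npairS.
- by case: x => [|x] //; rewrite npair0 => -[/IH /= ->].
- by rewrite npairS => -[/IH /= ->].
Qed.

Lemma nfstE x y : nfst (npair x y) = x. Proof. by rewrite /nfst unpairK. Qed.
Lemma nsndE x y : nsnd (npair x y) = y. Proof. by rewrite /nsnd unpairK. Qed.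

Lemma npair_inj x y x' y' : npair x y = npair x' y' -> x = x' /\ y = y'.
Proof. by move=> /(congr1 unpair); rewrite !unpairK => -[-> ->]. Qed.

Lemma leq_npairr x y : y <= npair x y. Proof. exact: leq_addl. Qed.

Lemma leq_npairl x y : x <= npair x y.
Proof. by rewrite /npair binS bin1; lia. Qed.

Class computable (f : nat -> nat) : Prop :=
  computable_code : exists c, forall x, computes c x (f x).

Lemma eq_computable f g : f =1 g -> computable f -> computable g.
Proof. by move=> fg [c cf]; exists c => x; rewrite -fg. Qed.

Lemma computable_comp f g : computable f -> computable g -> computable (fun x => f (g x)).
Proof. by move=> [c cf] [d dg]; exists (RComp c d) => x; exists (g x). Qed.

(* Function variables are only applied under this hint: as an instance,
   [computable_comp] would match every goal. *)
#[local] Hint Extern 2 (computable (fun x => ?f (@?g x))) =>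
  is_var f; apply (@computable_comp f g) : typeclass_instances.

Instance computable_zero : computable (fun=> 0).
Proof. by exists RZero. Qed.

Instance computable_npair f g :
  computable f -> computable g -> computable (fun x => npair (f x) (g x)).
Proof. by move=> [c cf] [d dg]; exists (RPair c d) => x; exists (f x), (g x). Qed.

Instance computable_id : computable id.
Proof.
exists (RPair RLeft RRight) => x; exists (nfst x), (nsnd x).
by split; [exists (nsnd x)|exists (nfst x)|]; rewrite npairK.
Qed.

Instance computable_succ : computable succn.
Proof. by exists RSucc. Qed.

Instance computable_succ_comp f : computable f -> computable (fun x => (f x).+1).
Proof. exact: computable_comp. Qed.

Instance computable_const k : computable (fun=> k).
Proof. elim: k => [|k IH]; exact _. Qed.

Instance computable_nfst : computable nfst.
Proof. by exists RLeft => x; exists (nsnd x); rewrite npairK. Qed.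

Instance computable_nfst_comp f : computable f -> computable (fun x => nfst (f x)).
Proof. exact: computable_comp. Qed.

Instance computable_nsnd : computable nsnd.
Proof. by exists RRight => x; exists (nfst x); rewrite npairK. Qed.

Instance computable_nsnd_comp f : computable f -> computable (fun x => nsnd (f x)).
Proof. exact: computable_comp. Qed.

Instance computable_iteri k g f :
  computable k -> computable f ->
  computable (fun z => g (nfst z) (nfst (nsnd z)) (nsnd (nsnd z))) ->
  computable (fun x => iteri (k x) (g x) (f x)).
Proof.
move=> ck [c cf] [d dg].
have ch : computable (fun z => iteri (nsnd z) (g (nfst z)) (f (nfst z))).
  exists (RPrec c d) => z; exists (nfst z), (nsnd z).
  exists (fun i => iteri i (g (nfst z)) (f (nfst z))).
  split=> //; first by rewrite npairK.
  move=> i _ /=; set r := iteri _ _ _; have := dg (npair (nfst z) (npair i r)).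
  by rewrite !nfstE !nsndE nfstE.
have : computable (fun x => npair x (k x)) by exact _.
by move=> /(computable_comp ch); apply: eq_computable => x; rewrite nfstE nsndE.
Qed.

Lemma computable_search (p : nat -> nat -> bool) :
  computable (fun z => ~~ p (nfst z) (nsnd z)) ->
  exists c, forall x y, p x y -> (forall i, i < y -> ~~ p x i) -> computes c x y.
Proof.
move=> [c cp]; exists (RMu c) => x y pxy min_y; split.
  by have := cp (npair x y); rewrite nfstE nsndE pxy.
by move=> i /min_y np; exists 0; have := cp (npair x i); rewrite nfstE nsndE np.
Qed.

Instance computable_addn f g :
  computable f -> computable g -> computable (fun x => f x + g x).
Proof.
move=> cf cg; have : computable (fun x => iteri (g x) (fun _ a => a.+1) (f x)) by exact _.
by apply: eq_computable => x; elim: (g x) => [|k /= ->]; rewrite ?addn0 ?addnS.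
Qed.

Instance computable_pred f : computable f -> computable (fun x => (f x).-1).
Proof.
move=> cf; have : computable (fun x => iteri (f x) (fun i _ => i) 0) by exact _.
by apply: eq_computable => x; case: (f x).
Qed.

Instance computable_subn f g :
  computable f -> computable g -> computable (fun x => f x - g x).
Proof.
move=> cf cg; have : computable (fun x => iteri (g x) (fun _ a => a.-1) (f x)) by exact _.
by apply: eq_computable => x; elim: (g x) => [|k /= ->]; rewrite ?subn0 ?subnS.
Qed.

Instance computable_muln f g :
  computable f -> computable g -> computable (fun x => f x * g x).
Proof.
move=> cf cg; have : computable (fun x => iteri (g x) (fun _ a => a + f x) 0) by exact _.
apply: eq_computable => x.
by elim: (g x) => [|k /= ->]; rewrite ?muln0 // mulnS addnC.
Qed.

Instance computable_expn f g :
  computable f -> computable g -> computable (fun x => f x ^ g x).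
Proof.
move=> cf cg; have : computable (fun x => iteri (g x) (fun _ a => f x * a) 1) by exact _.
by apply: eq_computable => x; elim: (g x) => [|k /= ->]; rewrite ?expn0 // expnS.
Qed.

Instance computable_if (b : nat -> bool) f g :
  computable b -> computable f -> computable g ->
  computable (fun x => if b x then f x else g x).
Proof.
move=> cb cf cg; have : computable (fun x => iteri (b x) (fun _ _ => f x) (g x)) by exact _.
by apply: eq_computable => x; case: (b x).
Qed.

Instance computable_negb (b : nat -> bool) : computable b -> computable (fun x => ~~ b x).
Proof.
move=> cb; have : computable (fun x => if b x then 0 else 1) by exact _.
by apply: eq_computable => x; case: (b x).
Qed.

Instance computable_andb (b c : nat -> bool) :
  computable b -> computable c -> computable (fun x => b x && c x).
Proof.
move=> cb cc; have : computable (fun x => if b x then nat_of_bool (c x) else 0) by exact _.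
by apply: eq_computable => x; case: (b x).
Qed.

Instance computable_orb (b c : nat -> bool) :
  computable b -> computable c -> computable (fun x => b x || c x).
Proof.
move=> cb cc; have : computable (fun x => if b x then 1 else nat_of_bool (c x)) by exact _.
by apply: eq_computable => x; case: (b x).
Qed.

Instance computable_leq f g :
  computable f -> computable g -> computable (fun x => f x <= g x).
Proof.
move=> cf cg; have : computable (fun x => iteri (f x - g x) (fun _ _ => 0) 1) by exact _.
by apply: eq_computable => x; rewrite /leq; case: (f x - g x).
Qed.

Instance computable_eqn f g :
  computable f -> computable g -> computable (fun x => f x == g x).
Proof.
move=> cf cg; have : computable (fun x => (f x <= g x) && (g x <= f x)) by exact _.
by apply: eq_computable => x; rewrite eqn_leq.
Qed.

Instance computable_eqb (b c : nat -> bool) :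
  computable b -> computable c -> computable (fun x => b x == c x).
Proof.
move=> cb cc; have : computable (fun x => (b x : nat) == c x) by exact _.
by apply: eq_computable => x; case: (b x); case: (c x).
Qed.

Definition bforall (k : nat) (p : pred nat) : bool := all p (iota 0 k).
Definition bexists (k : nat) (p : pred nat) : bool := has p (iota 0 k).

Lemma bforallP k (p : pred nat) : reflect (forall i, i < k -> p i) (bforall k p).
Proof.
apply: (iffP allP) => p_all i; last by rewrite mem_iota; apply: p_all.
by move=> ik; apply: p_all; rewrite mem_iota.
Qed.

Lemma bexistsP k (p : pred nat) : reflect (exists2 i, i < k & p i) (bexists k p).
Proof.
apply: (iffP hasP) => -[i]; first by rewrite mem_iota; exists i.
by move=> ik pi; exists i; rewrite // mem_iota.
Qed.

Instance computable_bforall k (p : nat -> nat -> bool) :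
  computable k -> computable (fun z => p (nfst z) (nsnd z)) ->
  computable (fun x => bforall (k x) (p x)).
Proof.
move=> ck cp; have cp' : computable (fun z => p (nfst z) (nfst (nsnd z))).
  have : computable (fun z => npair (nfst z) (nfst (nsnd z))) by exact _.
  by move=> /(computable_comp cp); apply: eq_computable => z; rewrite nfstE nsndE.
have : computable (fun x => iteri (k x) (fun i a => if p x i then a else 0) 1).
  exact _.
apply: eq_computable => x; rewrite /bforall; elim: (k x) => [|j IH] //.
rewrite -[in RHS]addn1 iotaD all_cat /= IH add0n andbT.
by case: (p x j); rewrite (andbT, andbF).
Qed.

Instance computable_bexists k (p : nat -> nat -> bool) :
  computable k -> computable (fun z => p (nfst z) (nsnd z)) ->
  computable (fun x => bexists (k x) (p x)).
Proof.
move=> ck cp; have : computable (fun x => ~~ bforall (k x) (fun i => ~~ p x i)) by exact _.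
by apply: eq_computable => x; rewrite /bforall /bexists all_predC negbK.
Qed.

Instance computable_divn f g :
  computable f -> computable g -> computable (fun x => f x %/ g x).
Proof.
move=> cf cg; pose step x i q := if i.+1 * g x <= f x then i.+1 else q.
have : computable (fun x => if 0 < g x then iteri (f x) (step x) 0 else 0).
  by rewrite /step; exact _.
apply: eq_computable => x; case: posnP => [->|g0]; first by rewrite divn0.
suff stepE k : iteri k (step x) 0 = minn k (f x %/ g x).
  by rewrite stepE; apply/minn_idPr; exact: leq_div.
by elim: k => [|k /= ->]; rewrite ?min0n // /step -leq_divRL //; case: leqP; lia.
Qed.

Instance computable_modn f g :
  computable f -> computable g -> computable (fun x => f x %% g x).
Proof.
move=> cf cg; have : computable (fun x => f x - f x %/ g x * g x) by exact _.
by apply: eq_computable => x; rewrite {1}(divn_eq (f x) (g x)) addKn.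
Qed.

(** * Digits and codes of sequences *)

Definition digit (a D i : nat) : nat := (D %/ a ^ i) %% a.

Fixpoint undigits (a K : nat) (f : nat -> nat) : nat :=
  if K is K'.+1 then f 0 + a * undigits a K' (fun i => f i.+1) else 0.

Lemma digit0 a D : digit a D 0 = D %% a.
Proof. by rewrite /digit expn0 divn1. Qed.

Lemma digitS a D i : digit a D i.+1 = digit a (D %/ a) i.
Proof. by rewrite /digit expnS divnMA. Qed.

Lemma digit_lt a D i : 0 < a -> digit a D i < a.
Proof. by rewrite /digit ltn_mod. Qed.

Lemma undigits_lt a K f : (forall i, i < K -> f i < a) -> undigits a K f < a ^ K.
Proof.
elim: K f => [|K IH] f fa //=; have f0 := fa 0 isT.
have := IH (fun i => f i.+1) (fun i iK => fa i.+1 iK); rewrite expnS.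
by set u := undigits _ _ _; set v := a ^ K; nia.
Qed.

Lemma digit_undigits a K f k : (forall i, i < K -> f i < a) -> k < K ->
  digit a (undigits a K f) k = f k.
Proof.
elim: K f k => [|K IH] f k fa //= kK; have f0 := fa 0 isT.
have a0 : 0 < a by lia.
case: k kK => [|k] kK; first by rewrite digit0 addnC mulnC modnMDl modn_small.
rewrite digitS addnC mulnC divnMDl // divn_small // addn0.
by rewrite IH // => i; apply: (fa i.+1).
Qed.

Lemma eq_digits a K D D' : D < a ^ K -> D' < a ^ K ->
  (forall k, k < K -> digit a D k = digit a D' k) -> D = D'.
Proof.
elim: K D D' => [|K IH] D D'; first by rewrite expn0 !ltnS !leqn0 => /eqP-> /eqP->.
rewrite expnS => lt_D lt_D' eqd; have a0 : 0 < a by lia.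
rewrite (divn_eq D a) (divn_eq D' a) -!digit0 eqd // (IH (D %/ a) (D' %/ a)) //.
- by rewrite ltn_divLR // mulnC.
- by rewrite ltn_divLR // mulnC.
- by move=> k kK; rewrite -!digitS eqd.
Qed.

Definition code_drop (c i : nat) : nat := iteri i (fun _ d => nsnd d.-1) c.
Definition code_nth (c i : nat) : nat := nfst (code_drop c i).-1.

Section CodeSeq.
Variables (T : Type) (f : T -> nat).

Lemma code_dropE s i : code_drop (code_seq f s) i = code_seq f (drop i s).
Proof.
rewrite /code_drop; elim: i => [|i /= ->]; first by rewrite drop0.
rewrite -add1n -drop_drop drop1; case: (drop i s) => [|x s'] //=.
by rewrite nsndE.
Qed.

Lemma code_drop_eq0 s i : (code_drop (code_seq f s) i == 0) = (size s <= i).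
Proof.
rewrite code_dropE leqNgt -[i < _]subn_gt0 -size_drop.
by case: (drop i s).
Qed.

Lemma code_nthE x0 s i :
  i < size s -> code_nth (code_seq f s) i = f (nth x0 s i).
Proof. by move=> si; rewrite /code_nth code_dropE (drop_nth x0) //= nfstE. Qed.

Lemma size_leq_code s : size s <= code_seq f s.
Proof.
elim: s => //= x s IH; rewrite ltnS; apply: leq_trans IH _; exact: leq_npairr.
Qed.

End CodeSeq.

Lemma code_seq_inj (T : Type) (f : T -> nat) :
  injective f -> injective (code_seq f).
Proof.
by move=> fi; elim=> [|x s IH] [|y t] //= [] /npair_inj[/fi-> /IH->].
Qed.

Lemma mem_leq_code (T : eqType) (f : T -> nat) x s : x \in s -> f x <= code_seq f s.
Proof.
elim: s => //= y s IH; rewrite inE => /orP[/eqP->|/IH xs].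
  by apply: leqW; exact: leq_npairl.
by apply: leqW; apply: leq_trans xs _; exact: leq_npairr.
Qed.

(* Bounding the quantifier by the code of the list is harmless: there is no
   cell at the indices from the size of the list on. *)
Definition code_all (c : nat) (p : pred nat) : bool :=
  bforall c (fun i => (code_drop c i == 0) || p (code_nth c i)).

Lemma code_allE (T : Type) (f : T -> nat) s p :
  code_all (code_seq f s) p = all (p \o f) s.
Proof.
apply/bforallP/idP => [p_all|/all_nthP p_all i _].
  case: s p_all => [|x0 s] // p_all; apply/(all_nthP x0) => i si.
  have := p_all i (leq_trans si (size_leq_code f _)).
  by rewrite code_drop_eq0 leqNgt si (code_nthE f x0 si).
rewrite code_drop_eq0; case: leqP => //= si; case: s si p_all => // x0 s si p_all.
by rewrite (code_nthE f x0 si); apply: p_all.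
Qed.

(** * The search for a table and the list of forbidden words *)

Definition edge_test (c u v : nat) : bool :=
  code_all c (fun w => w != (npair u (npair v 0).+1).+1).

Definition table_entry (a m tau D r i t : nat) : nat :=
  digit a D ((r * m + i) * tau + t).

Definition synchronization_test (c a tau m n D : nat) : bool :=
  bforall m (fun i => bforall m (fun j => bforall n (fun psi =>
    (j == i.+1 %% m) && (psi == 0) ||
    bexists n (fun r => bforall tau (fun t => bforall tau (fun t' =>
      ~~ edge_test c (table_entry a m tau D r i t)
           (table_entry a m tau D ((r + psi) %% n) j t'))))))).

Definition overlap_test (b R t t' : nat) : bool :=
  bforall (2 * R) (fun x => digit b t x.+1 == digit b t' x).

Definition transmission_test (c a b R tau m n D : nat) : bool :=
  bforall m (fun i => bforall tau (fun t => bforall tau (fun t' =>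
    bforall n (fun r => edge_test c (table_entry a m tau D r i t)
                          (table_entry a m tau D r (i.+1 %% m) t')) ==
    ((i.+1 == m) && overlap_test b R t t' || (i.+1 != m) && (t == t'))))).

Definition table_test (c a b R tau m n D : nat) : bool :=
  [&& 1 < m, 0 < n, synchronization_test c a tau m n D &
      transmission_test c a b R tau m n D].

Definition code_offset (R c : nat) : nat :=
  if c %% 2 == 1 then R - (c %/ 2).+1 else R + c %/ 2.

Lemma code_offsetE R z : absz z <= R -> code_offset R (code_int z) = absz (R%:Z + z)%R.
Proof.
rewrite /code_offset; case: z => k /= kR; rewrite -muln2.
  by rewrite modnMl mulnK // -PoszD.
by rewrite -addn1 modnMDl divnMDl //= addn0 NegzE; lia.
Qed.

Definition cell_test (b R tau S e : nat) : bool :=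
  digit b (digit tau S (code_offset R (nsnd (nfst e))).+1)
    (code_offset R (nfst (nfst e))) == nsnd e.

Definition stack_test (cF b R tau S : nat) : bool :=
  code_all cF (fun p => ~~ code_all p (cell_test b R tau S)).

Definition window_test (cF a b R tau m n D u : nat) : bool :=
  bexists m (fun j => bexists n (fun phi => bexists (tau ^ (2 * R + 4)) (fun S =>
    stack_test cF b R tau S &&
    bforall ((2 * R + 3) * n) (fun y =>
      digit a u y ==
      table_entry a m tau D ((y + phi) %% n) j (digit tau S ((y + phi) %/ n)))))).

Definition word_code (a l u : nat) : nat :=
  iteri l (fun i acc => (npair (digit a u (l - i.+1)) acc).+1) 0.

Definition bad_words_code (cF a b R tau m n D : nat) : nat :=
  iteri (a ^ ((2 * R + 3) * n)) (fun u acc =>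
    if window_test cF a b R tau m n D u then acc
    else (npair (word_code a ((2 * R + 3) * n) u) acc).+1) 0.

Instance computable_digit a D i :
  computable a -> computable D -> computable i ->
  computable (fun x => digit (a x) (D x) (i x)).
Proof. move=> *; rewrite /digit; exact _. Qed.

Instance computable_code_all c (p : nat -> nat -> bool) :
  computable c -> computable (fun z => p (nfst z) (nsnd z)) ->
  computable (fun x => code_all (c x) (p x)).
Proof.
move=> cc cp; have cp' : computable (fun z => p (nfst z) (code_nth (c (nfst z)) (nsnd z))).
  have : computable (fun z => npair (nfst z) (code_nth (c (nfst z)) (nsnd z))).
    by rewrite /code_nth /code_drop; exact _.
  by move=> /(computable_comp cp); apply: eq_computable => z; rewrite nfstE nsndE.
rewrite /code_all /code_drop; exact _.
Qed.

Instance computable_edge_test c u v :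
  computable c -> computable u -> computable v ->
  computable (fun x => edge_test (c x) (u x) (v x)).
Proof. move=> *; rewrite /edge_test; exact _. Qed.

Instance computable_table_entry a m tau D r i t :
  computable a -> computable m -> computable tau -> computable D ->
  computable r -> computable i -> computable t ->
  computable (fun x => table_entry (a x) (m x) (tau x) (D x) (r x) (i x) (t x)).
Proof. move=> *; rewrite /table_entry; exact _. Qed.

Instance computable_table_test c a b R tau m n D :
  computable c -> computable a -> computable b -> computable R ->
  computable tau -> computable m -> computable n -> computable D ->
  computable (fun x =>
    table_test (c x) (a x) (b x) (R x) (tau x) (m x) (n x) (D x)).
Proof.
move=> *; rewrite /table_test /synchronization_test /transmission_test /overlap_test.
exact _.
Qed.

Instance computable_stack_test cF b R tau S :
  computable cF -> computable b -> computable R -> computable tau ->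
  computable S ->
  computable (fun x => stack_test (cF x) (b x) (R x) (tau x) (S x)).
Proof. move=> *; rewrite /stack_test /cell_test /code_offset; exact _. Qed.

Instance computable_bad_words_code cF a b R tau m n D :
  computable cF -> computable a -> computable b -> computable R ->
  computable tau -> computable m -> computable n -> computable D ->
  computable (fun x =>
    bad_words_code (cF x) (a x) (b x) (R x) (tau x) (m x) (n x) (D x)).
Proof.
move=> *; rewrite /bad_words_code /window_test /word_code; exact _.
Qed.

Definition input_words x := nsnd (nfst x).
Definition input_letters x := nfst (nfst x).
Definition input_colors x := nfst (nsnd x).
Definition input_patterns x := nsnd (nsnd x).
Definition input_tiles x := input_colors x ^ (2 * input_patterns x).+1.

(* The positions in the patterns are bounded by the code of the list of
   patterns, which thus serves as the radius R. *)
Definition table_search (x z : nat) : bool :=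
  table_test (input_words x) (input_letters x) (input_colors x) (input_patterns x)
    (input_tiles x) (nfst z) (nfst (nsnd z)) (nsnd (nsnd z)).

Definition table_output (x z : nat) : nat :=
  npair (nfst z) (npair (nfst (nsnd z))
    (bad_words_code (input_patterns x) (input_letters x) (input_colors x)
       (input_patterns x) (input_tiles x) (nfst z) (nfst (nsnd z)) (nsnd (nsnd z)))).

Lemma table_searchE (A B : finType) (FH : seq (seq A)) (FY : seq (pattern B)) m n D :
  table_search (code_input FH FY) (npair m (npair n D)) =
  table_test (code_words FH) #|A| #|B| (code_patterns FY)
    (#|B| ^ (2 * code_patterns FY).+1) m n D.
Proof.
rewrite /table_search /input_tiles.
by rewrite /input_words /input_letters /input_colors /input_patterns !(nfstE, nsndE).
Qed.

Lemma table_outputE (A B : finType) (FH : seq (seq A)) (FY : seq (pattern B)) m n D :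
  table_output (code_input FH FY) (npair m (npair n D)) =
  npair m (npair n (bad_words_code (code_patterns FY) #|A| #|B| (code_patterns FY)
    (#|B| ^ (2 * code_patterns FY).+1) m n D)).
Proof.
rewrite /table_output /input_tiles.
by rewrite /input_letters /input_colors /input_patterns !(nfstE, nsndE).
Qed.

Lemma search_program : exists c, forall x,
  (exists z, table_search x z) ->
  exists2 z, table_search x z & computes c x (table_output x z).
Proof.
have search_computable : computable (fun z => ~~ table_search (nfst z) (nsnd z)).
  rewrite /table_search /input_tiles.
  rewrite /input_words /input_letters /input_colors /input_patterns; exact _.
have [c cP] := computable_search search_computable.
have [d dP] : computable (fun e => table_output (nfst e) (nsnd e)).
  rewrite /table_output /input_tiles /input_letters /input_colors /input_patterns.
  exact _.
have [i iP] := computable_id.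
exists (RComp d (RPair i c)) => x ex_z; case: (ex_minnP ex_z) => z found least.
exists z => //; exists (npair x z); last by have := dP (npair x z); rewrite nfstE nsndE.
exists x, z; split=> //; apply: cP => // k; rewrite ltnNge.
by apply: contra => /least.
Qed.

(** * The allowed edges and the Rauzy graph *)

Definition letter (A : finType) (a0 : A) (k : nat) : A := nth a0 (enum A) k.

Lemma code_letter_lt (A : finType) (a : A) : code_letter a < #|A|.
Proof. exact: ltn_ord. Qed.

Lemma code_letter_inj (A : finType) : injective (@code_letter A).
Proof. by move=> x y /val_inj /enum_rank_inj. Qed.

Lemma code_letterK (A : finType) (a0 : A) : cancel (@code_letter A) (letter a0).
Proof. by move=> a; rewrite /letter /code_letter nth_enum_rank. Qed.

Lemma letterK (A : finType) (a0 : A) k : k < #|A| -> code_letter (letter a0 k) = k.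
Proof.
move=> kA; rewrite /letter -[k]/(val (Ordinal kA)) -enum_val_nth /code_letter.
by rewrite enum_valK.
Qed.

Section AllowedEdges.
Variables (A : finType) (FH : seq (seq A)).

Definition allowed : rel A := fun a b => [:: a; b] \notin FH.

Lemma edge_testE a b :
  edge_test (code_words FH) (code_letter a) (code_letter b) = allowed a b.
Proof.
rewrite /edge_test /code_words code_allE /allowed -has_pred1 -all_predC.
apply: eq_all => w /=.
rewrite -(inj_eq (code_seq_inj (@code_letter_inj A))).
by rewrite eq_sym.
Qed.

Hypothesis FH2 : length2 FH.

Lemma sft1_allowed : sft1 FH = biinfinite_walks allowed.
Proof.
apply/seteqP; split=> x Hx.
  move=> i; apply/negP => abF; apply: (Hx _ i abF).
  by rewrite /word_at /mkseq /= addr0.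
move=> w i wF; have /eqP := allP FH2 w wF; case: w wF => [|a [|b [|]]] // wF _.
by rewrite /word_at /mkseq /= addr0 => -[ea eb]; have := Hx i; rewrite ea eb /allowed wF.
Qed.

Definition rauzy : rel A := fun a b => `[< rauzy_edge (sft1 FH) a b >].

Lemma rauzy_allowed a b : rauzy a b -> allowed a b.
Proof.
move=> /asboolP[x + [i]]; rewrite sft1_allowed => Hx.
by rewrite /word_at /mkseq /= addr0 => -[<- <-]; exact: Hx.
Qed.

(* Turn around a in the past and around b in the future. *)
Lemma allowed_rauzy a b k l : walk rauzy k.+1 a a -> walk rauzy l.+1 b b ->
  allowed a b -> rauzy a b.
Proof.
have periodic_walk c j : walk rauzy j.+1 c c ->
    exists o : int -> A, o 0%R = c /\ biinfinite_walks allowed o.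
  move=> cc; have [|o [_ oE] [o0 _]] := closed_walk_through cc ((walk0 _ c c).2 erefl).
    by rewrite addn0.
  by exists o; split=> // i; apply: rauzy_allowed.
move=> /periodic_walk[f [f0 fE]] /periodic_walk[g [g0 gE]] ab; apply/asboolP.
pose x (i : int) := if (i <= 0)%R then f i else g (i - 1)%R.
exists x; last by exists 0%R; rewrite /word_at /mkseq /= /x /= f0 subrr g0.
rewrite sft1_allowed => i; rewrite /x; have [i0|i0] := boolP (i <= 0)%R; last first.
  have -> : (i + 1 <= 0)%R = false by lia.
  by have := gE (i - 1)%R; rewrite addrAC.
have [i1|i1] := boolP (i + 1 <= 0)%R; first exact: fE.
by have -> : i = 0%R by [lia]; rewrite f0 add0r subrr g0.
Qed.

End AllowedEdges.

(** * The program finds a table *)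

Lemma ltn_mul_add q Q x d : q < Q -> x < d -> q * d + x < Q * d.
Proof. nia. Qed.

Section Coding.
Variables (B : finType) (FY : seq (pattern B)).
Let R := code_patterns FY.
Let b := #|B|.
Let tau := b ^ (2 * R).+1.

Lemma tile_card_gt0 (t : 'I_tau) : 0 < b.
Proof.
by have := leq_ltn_trans (leq0n t) (ltn_ord t); rewrite /tau expn_gt0 orbF.
Qed.

Definition tile_letter (t : 'I_tau) (x : nat) : B :=
  enum_val (Ordinal (digit_lt t x (tile_card_gt0 t))).

Lemma code_tile_letter t x : code_letter (tile_letter t x) = digit b t x.
Proof. by rewrite /code_letter enum_valK. Qed.

Definition tile_of (s : nat -> B) : 'I_tau :=
  Ordinal (@undigits_lt b (2 * R).+1 (fun x => code_letter (s x))
    (fun x _ => code_letter_lt (s x))).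

Lemma tile_letter_of s x : x <= 2 * R -> tile_letter (tile_of s) x = s x.
Proof.
move=> xR; apply: code_letter_inj; rewrite code_tile_letter digit_undigits // => i _.
exact: code_letter_lt.
Qed.

Lemma tile_letter_ext t t' :
  (forall x, x <= 2 * R -> tile_letter t x = tile_letter t' x) -> t = t'.
Proof.
move=> tt'; apply/val_inj/(@eq_digits b (2 * R).+1); try exact: ltn_ord.
by move=> x xR; rewrite -!code_tile_letter tt'.
Qed.

Lemma patterns_radius p c : p \in FY -> c \in p ->
  absz c.1.1 <= R /\ absz c.1.2 <= R.
Proof.
move=> pF cp; have absz_code z : absz z <= code_int z by case: z => k /=; lia.
have code_c := leq_trans (mem_leq_code (code_pair (code_pair code_int code_int)
  (@code_letter B)) cp) (mem_leq_code (code_seq _) pF).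
have code_c1 := leq_trans (leq_npairl _ _) code_c.
by split; apply: leq_trans (absz_code _) (leq_trans _ code_c1);
  [exact: leq_npairl|exact: leq_npairr].
Qed.

Let overlap := overlap R tile_letter.

Lemma overlap_testE (t t' : 'I_tau) : overlap_test b R t t' <-> overlap t t'.
Proof.
split=> [/bforallP tt' x xR|tt'].
  by apply: code_letter_inj; rewrite !code_tile_letter; apply/eqP/tt'.
by apply/bforallP => x xR; rewrite -!code_tile_letter tt'.
Qed.

Lemma stack_testP N (S : nat -> 'I_tau) :
  (forall k, k < 2 * R + 4 -> digit tau N k = S k) ->
  stack_test R b R tau N <-> valid_stack R tile_letter FY S.
Proof.
move=> NS; rewrite /stack_test {1}/R /code_patterns code_allE.
pose g := code_pair (code_pair code_int code_int) (@code_letter B).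
pose shown c :=
  tile_letter (S (absz (R%:Z + c.1.2)%R).+1) (absz (R%:Z + c.1.1)%R) == c.2.
have cellE p c : p \in FY -> c \in p -> cell_test b R tau N (g c) = shown c.
  move=> pF cp; have [c1 c2] := patterns_radius pF cp.
  rewrite /cell_test /g /code_pair !(nfstE, nsndE) !code_offsetE // NS; last first.
    by move: c2; move: (R) (c.1.2) => R' z; lia.
  by rewrite -code_tile_letter (inj_eq (@code_letter_inj B)).
have patternE p : p \in FY ->
    code_all (code_seq g p) (cell_test b R tau N) = all shown p.
  by move=> pF; rewrite code_allE; apply: eq_in_all => c cp; apply: cellE cp.
split=> [/allP test p pF all_shown|valid].
  have := test p pF; rewrite /= patternE // => /negP; apply.
  by apply/allP => c /all_shown shown_c; apply/eqP.
apply/allP => p pF; rewrite /= patternE //; apply/negP => /allP all_shown.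
by apply: (valid p pF) => c /all_shown /eqP.
Qed.

Variables (A : finType) (a0 : A).
Let a := #|A|.
Let a_gt0 : 0 < a. Proof. by apply/card_gt0P; exists a0. Qed.

Section Table.
Variables m n : nat.

Definition entry_of (D r i : nat) (t : 'I_tau) : A :=
  letter a0 (table_entry a m tau D r i t).

Definition table_of (D : nat) (r i : int) (t : 'I_tau) : A :=
  entry_of D (absz (r %% n)%Z) (absz (i %% m)%Z) t.

Lemma table_ofE D r r' i i' t : r' < n -> i' < m -> (r = r'%:Z %[mod n])%Z ->
  (i = i'%:Z %[mod m])%Z -> table_of D r i t = entry_of D r' i' t.
Proof. by move=> rn im er ei; rewrite /table_of (absz_mod rn er) (absz_mod im ei). Qed.

Let l := (2 * R + 3) * n.

Definition shown_letter (u y : nat) : A := letter a0 (digit a u y).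

Definition word_of (u : nat) : seq A := mkseq (shown_letter u) l.

Definition bad_words (D : nat) : seq (seq A) :=
  [seq word_of u | u <- rev (iota 0 (a ^ l)) & ~~ window_test R a b R tau m n D u].

Lemma word_codeE u : word_code a l u = code_seq (@code_letter A) (word_of u).
Proof.
pose acc i := iteri i (fun k c => (npair (digit a u (l - k.+1)) c).+1) 0.
suff accE i : i <= l -> acc i = code_seq (@code_letter A) (drop (l - i) (word_of u)).
  by rewrite /word_code -/(acc l) accE // subnn drop0.
elim: i => [|i IH] il; first by rewrite subn0 drop_oversize // size_mkseq.
rewrite /acc /= -/(acc i) IH 1?ltnW // [in RHS](drop_nth a0); last first.
  by rewrite size_mkseq; lia.
rewrite /= nth_mkseq; last by lia.
by rewrite letterK ?digit_lt // -subSn // subSS.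
Qed.

Lemma bad_words_codeE D : bad_words_code R a b R tau m n D = code_words (bad_words D).
Proof.
rewrite /bad_words_code /bad_words -/l; elim: (a ^ l) => [|k IH] //.
rewrite -{2}[k.+1]addn1 iotaD rev_cat /= add0n IH.
by case: window_test => //=; rewrite word_codeE.
Qed.

Hypotheses (m0 : 0 < m) (n0 : 0 < n).

Lemma table_of_surjective (F : int -> int -> 'I_tau -> A) :
    (forall i t, periodic n (fun r => F r i t)) ->
    (forall r t, periodic m (fun i => F r i t)) ->
  exists D, table_of D = F.
Proof.
move=> pn pm; pose f k := if insub (k %% tau) is Some t then
  code_letter (F (Posz (k %/ tau %/ m)) (Posz (k %/ tau %% m)) t) else 0.
have f_lt k : f k < a by rewrite /f; case: insub => // t; exact: code_letter_lt.
exists (undigits a (n * m * tau) f).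
apply/funext => r; apply/funext => i; apply/funext => t.
have [[r' rn er] [i' im ei]] := (int_residue r n0, int_residue i m0).
rewrite (table_ofE _ t rn im er ei) /entry_of /table_entry digit_undigits //; last first.
  exact: ltn_mul_add (ltn_mul_add rn im) (ltn_ord t).
have tau0 : 0 < tau := leq_ltn_trans (leq0n t) (ltn_ord t).
have tile_quotient : ((r' * m + i') * tau + t) %/ tau = r' * m + i'.
  by rewrite divnMDl // divn_small ?addn0.
rewrite /f modnMDl modn_small // valK code_letterK tile_quotient.
rewrite modnMDl modn_small // divnMDl // divn_small // addn0.
by rewrite (eq_periodic (pn i t) er) (eq_periodic (pm r' t) ei).
Qed.

Lemma window_testP D u : window_test R a b R tau m n D u <->
  exists j phi S, reads R tile_letter FY n (table_of D) (shown_letter u) j phi S.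
Proof.
have block_lt y phi : y < l -> phi < n -> (y + phi) %/ n < 2 * R + 4.
  by move=> yl pn; rewrite ltn_divLR //; move: yl; rewrite /l; nia.
have entryE j j' y phi t : j' < m -> (j = j'%:Z %[mod m])%Z ->
    table_of D (Posz (y + phi)) j t = entry_of D ((y + phi) %% n) j' t.
  by move=> jm ej; apply: table_ofE; rewrite ?ltn_mod // -modz_nat modz_mod.
split.
  move=> /bexistsP[j jm /bexistsP[phi pn /bexistsP[N Nt /andP[st /bforallP shown]]]].
  have tau0 : 0 < tau.
    by move: (leq_ltn_trans (leq0n _) Nt); rewrite expn_gt0 addnC orbF.
  exists (Posz j), phi, (fun k => Ordinal (digit_lt N k tau0)); split=> //.
    exact: (stack_testP (N := N) _).1 st.
  by move=> y yl; rewrite (entryE _ j) // /entry_of /=; congr letter; apply/eqP/shown.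
move=> [j [phi [S [pn valid shown]]]]; have [j' jm ej] := int_residue j m0.
apply/bexistsP; exists j' => //; apply/bexistsP; exists phi => //.
pose N := undigits tau (2 * R + 4) (fun k => S k).
have NS k : k < 2 * R + 4 -> digit tau N k = S k.
  by move=> kR; rewrite digit_undigits.
apply/bexistsP; exists N; first exact: undigits_lt.
apply/andP; split; first exact/(stack_testP NS).
apply/bforallP => y yl; rewrite NS ?block_lt //; apply/eqP.
have /(congr1 (@code_letter A)) := shown y yl.
by rewrite (entryE _ j') // !letterK ?digit_lt.
Qed.

Lemma sft1_bad_words D : sft1 (bad_words D) = stack_columns R tile_letter FY n (table_of D).
Proof.
pose number (x : nat -> A) := undigits a l (fun k => code_letter (x k)).
have number_lt x : number x < a ^ l by apply: undigits_lt => i _; exact: code_letter_lt.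
have numberK x k : k < l -> shown_letter (number x) k = x k.
  move=> kl; rewrite /shown_letter digit_undigits ?code_letterK // => i _.
  exact: code_letter_lt.
apply/seteqP; split=> x.
  move=> x_ok y0; pose u := number (fun k => x (y0 + k%:Z)%R).
  have [/window_testP[j [phi [S [pn valid shown]]]]|bad] :=
      boolP (window_test R a b R tau m n D u).
    by exists j, phi, S; split=> // y yl; rewrite -shown // numberK.
  have bad_u : word_of u \in bad_words D.
    by apply/mapP; exists u; rewrite // mem_filter bad mem_rev mem_iota number_lt.
  case: (x_ok _ y0 bad_u); rewrite /word_at size_mkseq.
  by apply/eq_in_map => k; rewrite mem_iota => kl; rewrite numberK.
move=> Vx w i /mapP[u]; rewrite mem_filter => /andP[/negP bad _] -> at_i; apply: bad.
have shown_u k : k < l -> shown_letter u k = x (i + k%:Z)%R.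
  move=> kl; move: at_i; rewrite /word_at size_mkseq => /(congr1 (fun s => nth a0 s k)).
  by rewrite !nth_mkseq.
apply/window_testP; have [j [phi [S [pn valid shown]]]] := Vx i.
by exists j, phi, S; split=> // y yl; rewrite shown_u // shown.
Qed.

Variable FH : seq (seq A).
Let E := allowed FH.
Let cH := code_words FH.

Lemma edge_entry_of D r i (t : 'I_tau) r' i' (t' : 'I_tau) :
  edge_test cH (table_entry a m tau D r i t) (table_entry a m tau D r' i' t') =
  E (entry_of D r i t) (entry_of D r' i' t').
Proof. by rewrite /E -edge_testE !letterK // digit_lt. Qed.

Let succ_mod (i : int) (k : nat) : (i = k%:Z %[mod m])%Z ->
  (i + 1 = (k.+1 %% m)%N%:Z %[mod m])%Z.
Proof. by move=> ik; rewrite -modzDml ik modzDml -modz_nat modz_mod -addn1. Qed.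

Lemma synchronization_testP D : reflect
  (forall i j psi : int, ~~ ((m %| j - (i + 1))%Z && (n %| psi)%Z) ->
     exists r, forall t t', ~~ E (table_of D r i t) (table_of D (r + psi) j t'))%R
  (synchronization_test cH a tau m n D).
Proof.
apply: (iffP (bforallP _ _)) => [sync i j psi ne|sync i im].
  have [[i' im ei] [j' jm ej]] := (int_residue i m0, int_residue j m0).
  have [psi' psin epsi] := int_residue psi n0.
  have /bforallP/(_ j' jm)/bforallP/(_ psi' psin) := sync i' im.
  case/orP => [/andP[/eqP ji /eqP psi0]|].
    case/negP: ne; rewrite -eqz_mod_dvd ej ji (succ_mod ei) eqxx /=.
    by apply/dvdz_mod0P; rewrite epsi psi0 mod0z.
  move=> /bexistsP[r rn nE]; exists (Posz r) => t t'.
  rewrite (table_ofE _ t rn im) //.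
  rewrite (table_ofE _ (r' := (r + psi') %% n) t' _ jm) ?ltn_mod //.
    have /bforallP/(_ t (ltn_ord t))/bforallP/(_ t' (ltn_ord t')) := nE.
    by rewrite edge_entry_of.
  by rewrite -modzDmr epsi modzDmr -PoszD -modz_nat modz_mod.
apply/bforallP => j jm; apply/bforallP => psi psin.
apply/norP => -[ne /bexistsP nE]; apply: nE.
have [|r nE] := sync (Posz i) (Posz j) (Posz psi).
  apply: contra ne => /andP[]; rewrite -eqz_mod_dvd (succ_mod (erefl (i%:Z %% m)%Z)).
  rewrite !modz_nat eqz_nat modn_mod (modn_small jm) => ->.
  by rewrite dvdzE /= /dvdn modn_small.
have [r' rn er] := int_residue r n0; exists r' => //.
apply/bforallP => t tt; apply/bforallP => t' tt'.
rewrite (edge_entry_of D r' i (Ordinal tt) ((r' + psi) %% n) j (Ordinal tt')).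
rewrite -(table_ofE D (r := r) (i := Posz i)) //.
rewrite -(table_ofE D (r := (r + psi)%R) (i := Posz j)) ?ltn_mod //.
by rewrite -modzDml er modzDml -PoszD -modz_nat modz_mod.
Qed.

Lemma transmission_testP D : reflect
  (forall i t t', (forall r, E (table_of D r i t) (table_of D r (i + 1) t')) <->
     (if (m %| i + 1)%Z then overlap t t' else t = t'))%R
  (transmission_test cH a b R tau m n D).
Proof.
pose rows i t t' := bforall n (fun r => edge_test cH (table_entry a m tau D r i t)
  (table_entry a m tau D r (i.+1 %% m) t')).
pose rel i t t' := (i.+1 == m) && overlap_test b R t t' || (i.+1 != m) && (t == t').
have rowsP (i : int) i' (t t' : 'I_tau) : i' < m -> (i = i'%:Z %[mod m])%Z ->
    rows i' t t' <-> forall r, E (table_of D r i t) (table_of D r (i + 1)%R t').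
  move=> im ei; split=> [/bforallP edge r|edge].
    have [r' rn er] := int_residue r n0.
    rewrite (table_ofE _ t rn im) // (table_ofE _ t' rn _ er (succ_mod ei)) ?ltn_mod //.
    by rewrite -edge_entry_of edge.
  apply/bforallP => r rn; rewrite edge_entry_of -(table_ofE D (r := Posz r) (i := i)) //.
  by rewrite -(table_ofE D (r := Posz r) (i := (i + 1)%R)) ?ltn_mod //; apply: succ_mod.
have relP (i : int) i' (t t' : 'I_tau) : i' < m -> (i = i'%:Z %[mod m])%Z ->
    rel i' t t' <-> if (m %| (i + 1)%R)%Z then overlap t t' else t = t'.
  move=> im ei; have -> : (m %| (i + 1)%R)%Z = (i'.+1 == m).
    by rewrite -dvdz_succ_small //; apply: eq_mod_dvdz; rewrite -modzDml ei modzDml.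
  rewrite /rel; case: eqP => _ /=; first by rewrite orbF; exact: overlap_testE.
  by split=> [/eqP/val_inj|->].
have cellP (i : int) i' (t t' : 'I_tau) : i' < m -> (i = i'%:Z %[mod m])%Z ->
    rows i' t t' == rel i' t t' <->
    ((forall r, E (table_of D r i t) (table_of D r (i + 1)%R t')) <->
      (if (m %| (i + 1)%R)%Z then overlap t t' else t = t')).
  move=> im ei; rewrite -(rowsP _ _ _ _ im ei) -(relP _ _ _ _ im ei).
  split=> [/eqP->//|[rows_rel rel_rows]].
  by apply/eqP; apply/idP/idP; [exact: rows_rel|exact: rel_rows].
apply: (iffP (bforallP _ _)) => [trans i t t'|trans i im].
  have [i' im ei] := int_residue i m0; apply/(cellP i i') => //.
  by have /bforallP/(_ t (ltn_ord t))/bforallP/(_ t' (ltn_ord t')) := trans i' im.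
apply/bforallP => t tt; apply/bforallP => t' tt'.
exact/(cellP (Posz i) i (Ordinal tt) (Ordinal tt')).
Qed.

Lemma table_testP D : 1 < m ->
  table_test cH a b R tau m n D <->
  transmission_table E m n overlap (table_of D).
Proof.
move=> m1; rewrite /table_test m1 n0 /=; split.
  move=> /andP[/synchronization_testP sync /transmission_testP trans].
  by split=> // [i t r|r t i]; rewrite /table_of modzDr.
by case=> _ _ /synchronization_testP-> /transmission_testP.
Qed.

End Table.

Variable FH : seq (seq A).
Hypothesis FH2 : length2 FH.

Lemma root_of_table_test m n D :
    table_test (code_words FH) a b R tau m n D ->
  [/\ 0 < m, 0 < n &
      is_root m n (combined (sft1 FH) (sft1 (bad_words m n D))) (sft2 FY)].
Proof.
move=> test; have /and4P[m1 n0 _ _] := test; have m0 := ltnW m1; split=> //.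
rewrite sft1_allowed // sft1_bad_words //.
apply: (root_of_transmission_table tile_letter_of) => //.
- exact: tile_letter_ext.
- exact: patterns_radius.
- exact/(table_testP m0 n0 FH D m1).
Qed.

Lemma table_search_succeeds : ~ condition_D (rauzy_edge (sft1 FH)) ->
  exists z, table_search (code_input FH FY) z.
Proof.
move=> nD; have {}nD : ~ condition_D (fun u v => rauzy FH u v).
  suff -> : (fun u v => is_true (rauzy FH u v)) = rauzy_edge (sft1 FH) by [].
  by apply/funext => u; apply/funext => v; apply/propext; split=> /asboolP.
pose right t := [ffun x : 'I_(2 * R) => tile_letter t x.+1].
pose left t := [ffun x : 'I_(2 * R) => tile_letter t x].
have [m [n [F [m1 n0 table cyc]]]] := transmission_table_exists right left nD.
have overlapE : (fun t t' => right t = left t') = overlap.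
  apply/funext => t; apply/funext => t'; apply/propext; split=> [/ffunP tt' x xR|tt'].
    by have := tt' (Ordinal xR); rewrite !ffunE.
  by apply/ffunP => x; rewrite !ffunE tt'.
have {}table : transmission_table (allowed FH) m n overlap F.
  rewrite -overlapE; apply: eq_transmission_table table => r i t r' i' t'.
  apply/idP/idP; first exact: rauzy_allowed.
  have [[k wk] [k' wk']] := (cyc r i t, cyc r' i' t').
  exact: allowed_rauzy wk wk'.
have [D DF] := table_of_surjective (ltnW m1) n0 (table_periodic_height table)
  (table_periodic_type table).
exists (npair m (npair n D)); rewrite table_searchE.
by apply/(table_testP (ltnW m1) n0 FH D m1); rewrite DF.
Qed.

End Coding.

Lemma table_program : exists c : recfun, forall (A : finType) (FH : seq (seq A)),
  length2 FH -> ~ condition_D (rauzy_edge (sft1 FH)) ->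
  forall (B : finType) (FY : seq (pattern B)), exists (a0 : A) (m n D : nat),
  table_test (code_words FH) #|A| #|B| (code_patterns FY)
    (#|B| ^ (2 * code_patterns FY).+1) m n D /\
  computes c (code_input FH FY) (code_output m n (bad_words FY a0 m n D)).
Proof.
have [c cP] := search_program; exists c => A FH FH2 nD B FY.
have [a0 _|A0] := pickP A; last first.
  by case: nD; constructor 1 => S [[v _] _ _]; have := A0 v.
have [z] := cP _ (table_search_succeeds FY a0 FH2 nD).
rewrite -[z]npairK -[nsnd z]npairK table_searchE table_outputE => test cmp.
exists a0, (nfst z), (nfst (nsnd z)), (nsnd (nsnd z)); split=> //.
by rewrite /code_output -bad_words_codeE.
Qed.

Theorem theorem4p1 :
  (forall (A : finType) (H : set (int -> A)),
     nearest_neighbor H -> ~ condition_D (rauzy_edge H) ->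
   forall (B : finType) (Y : set (conf2 B)), is_sft2 Y ->
   exists2 V : set (int -> A), is_sft1 V &
   exists m n : nat,
     [/\ (0 < m)%N, (0 < n)%N & is_root m n (combined H V) Y]) /\
  (exists c : recfun,
   forall (A : finType) (FH : seq (seq A)),
     length2 FH -> ~ condition_D (rauzy_edge (sft1 FH)) ->
   forall (B : finType) (FY : seq (pattern B)),
   exists (m n : nat) (FV : seq (seq A)),
     [/\ computes c (code_input FH FY) (code_output m n FV),
         (0 < m)%N, (0 < n)%N &
         is_root m n (combined (sft1 FH) (sft1 FV)) (sft2 FY)]).
Proof.
have [c cP] := table_program; split=> [A H [FH FH2 ->] nD B Y [FY ->]|].
  have [a0 [m [n [D [test _]]]]] := cP A FH FH2 nD B FY.
  exists (sft1 (bad_words FY a0 m n D)); first by exists (bad_words FY a0 m n D).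
  by exists m, n; exact: root_of_table_test.
exists c => A FH FH2 nD B FY.
have [a0 [m [n [D [test computed]]]]] := cP A FH FH2 nD B FY.
exists m, n, (bad_words FY a0 m n D).
by have [m0 n0 root] := root_of_table_test a0 FH2 test.
Qed.
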